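(* Let $\kappa,\lambda$ be infinite cardinals, let $\alpha$ be an infinite cardinal with $\alpha\leq\kappa^+$, and let $\beta$ be an infinite cardinal with $\beta\leq\lambda^+$. Then $P(\kappa,\alpha)$ is isomorphic to a subgroup of $P(\lambda,\beta)$ if and only if either (1) $\kappa\leq\lambda$ and $\alpha\leq\beta$, or (2) $\kappa\leq\lambda^{<\beta}$ and $\alpha=\omega$.
   Context: Cardinals are initial ordinals, identified with the set of smaller ordinals; $\omega$ is the first infinite cardinal and $\kappa^+$ is the successor cardinal of $\kappa$. For an infinite cardinal $\kappa$, $\mathbb{Z}^\kappa$ is the direct product of $\kappa$ copies of the additive group $\mathbb{Z}$, i.e. the group of functions $x:\kappa\to\mathbb{Z}$ under pointwise addition. The support of $x$ is $\mathrm{supp}(x)=\{\xi\in\kappa:x(\xi)\neq 0\}$. For an infinite cardinal $\alpha\leq\kappa^+$, $P(\kappa,\alpha)=\{x\in\mathbb{Z}^\kappa:|\mathrm{supp}(x)|<\alpha\}$, a subgroup of $\mathbb{Z}^\kappa$ (so $P(\kappa,\kappa^+)=\mathbb{Z}^\kappa$ and $P(\kappa,\omega)$ is the direct sum of $\kappa$ copies of $\mathbb{Z}$). $\lambda^{<\beta}$ denotes the cardinality of the set of functions into $\lambda$ whose domain is a cardinal less than $\beta$ (equivalently $\sup_{\gamma<\beta}\lambda^\gamma$). *)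

(* Defs.v *)
(* Cardinals are represented by types (up to equinumerosity):
   a cardinal kappa is represented by a type K whose elements are the smaller
   ordinals; only the cardinality of K matters for the statement. *)
From Stdlib Require Import ZArith.
Open Scope Z_scope.

Definition cle (X Y : Type) : Prop :=
  exists f : X -> Y, forall x y, f x = f y -> x = y.

Definition clt (X Y : Type) : Prop := cle X Y /\ ~ cle Y X.

Definition ceq (X Y : Type) : Prop :=
  exists f : X -> Y, (forall x y, f x = f y -> x = y) /\ (forall y, exists x, f x = y).

Definition infinite_card (X : Type) : Prop := cle nat X.

(* alpha <= kappa^+  (A represents alpha, K represents kappa):
   every cardinal below alpha (realised as a subset of alpha) is <= kappa. *)
Definition le_succ (A K : Type) : Prop :=
  forall S : A -> Prop, clt {a : A | S a} A -> cle {a : A | S a} K.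

Definition supp {K : Type} (x : K -> Z) : Type := {k : K | x k <> 0}.

Definition inP (K A : Type) (x : K -> Z) : Prop := clt (supp x) A.

(* kappa <= lambda^{<beta}: the set of functions into lambda whose domain is a
   cardinal gamma < beta.  The cardinals gamma < beta are realised by a system R
   of representatives: subsets of beta, each of cardinality < beta, pairwise
   non-equinumerous, and every cardinality < beta is represented. *)
Definition le_pow_lt (K L B : Type) : Prop :=
  exists R : (B -> Prop) -> Prop,
    (forall S, R S -> clt {b : B | S b} B) /\
    (forall S T, R S -> R T -> ceq {b : B | S b} {b : B | T b} -> S = T) /\
    (forall S, clt {b : B | S b} B ->
       exists T, R T /\ ceq {b : B | S b} {b : B | T b}) /\
    cle K {p : {S : B -> Prop | R S} & ({b : B | proj1_sig p b} -> L)}.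

(* P(kappa, alpha) is isomorphic to a subgroup of P(lambda, beta):
   an injective group homomorphism P(kappa,alpha) -> P(lambda,beta)
   (given as a function on Z^kappa, only its values on P(kappa,alpha) matter). *)
Definition P_embeds (K A L B : Type) : Prop :=
  exists f : (K -> Z) -> (L -> Z),
    (forall x, inP K A x -> inP L B (f x)) /\
    (forall x y, inP K A x -> inP K A y ->
        f (fun k => x k + y k) = (fun l => f x l + f y l)) /\
    (forall x y, inP K A x -> inP K A y -> f x = f y -> x = y).

(* Main.v *)
(** Let [f] embed [P(kappa, alpha)] into [P(lambda, beta)].  If [alpha] is countable,
    then [kappa <= |P(lambda, beta)| <= lambda^{<beta}].  Otherwise Specker's theorem
    applies to the coordinates of [f]: for each [l], only finitely many [k] have
    [f (delta k) l <> 0], whence [kappa <= lambda].  If moreover [beta < alpha], then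
    [Z^beta] embeds into [P(lambda, beta)].  To refute this one needs an [x] in
    [Z^beta] whose image has [beta] nonzero coordinates.  A homomorphism
    [phi : Z^beta -> Z] need not be determined by its values on the unit vectors (if
    there are measurable cardinals), but no infinitely many disjoint sets [Y] have
    [phi <> 0] on [Z^Y], so it has a finite rank.  When [beta] is not a countable
    union of smaller sets, a minimal-rank argument produces a set [T] of size [beta]
    whose indicator function is such an [x]; when it is, one glues countably many
    functions with images of larger and larger support.

    Conversely, for [alpha = omega] one needs [lambda^{<beta}] linearly independent
    elements of [P(lambda, beta)].  The subsets [G] of [lambda] with fewer than [beta]
    elements provide them, as the indicator functions of the finite sequences in
    [G]. *)
Require Import Defs.
From Stdlib Require Import ZArith.
From Stdlib Require Import Lia List FinFun Permutation Cantor Znumtheory Zpow_facts.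
From Stdlib Require Import Classical ClassicalEpsilon FunctionalExtensionality.
From Stdlib Require Import PropExtensionality ProofIrrelevance.
From mathcomp Require boolp classical_sets.
Set Bullet Behavior "Strict Subproofs".

(** * Cardinal arithmetic *)

Lemma sig_eq {X} {P : X -> Prop} (a b : {x | P x}) :
  proj1_sig a = proj1_sig b -> a = b.
Proof.
  destruct a as [a pa], b as [b pb]; simpl; intros <-.
  f_equal; apply proof_irrelevance.
Qed.

Lemma fun_choice {X Y} (R : X -> Y -> Prop) :
  (forall x, exists y, R x y) -> exists f, forall x, R x (f x).
Proof.
  intros H.
  exists (fun x => proj1_sig (constructive_indefinite_description _ (H x))).
  intros x; exact (proj2_sig (constructive_indefinite_description _ (H x))).
Qed.

Lemma zorn_preorder {T : Type} (t0 : T) (R : T -> T -> Prop) :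
  (forall t, R t t) -> (forall r s t, R r s -> R s t -> R r t) ->
  (forall C : T -> Prop, (forall s t, C s -> C t -> R s t \/ R t s) ->
     exists t, forall s, C s -> R s t) ->
  exists t, forall s, R t s -> R s t.
Proof.
  intros Hr Ht Hc.
  destruct (@classical_sets.ZL_preorder T t0 (fun x y => boolp.asbool (R x y)))
    as [t Hm].
  - intros t; apply boolp.asboolT, Hr.
  - intros r s t H1 H2; apply boolp.asboolW in H1, H2.
    apply boolp.asboolT; eauto.
  - intros C HC; destruct (Hc C) as [t Hu].
    + intros r s Cr Cs.
      destruct (HC r s Cr Cs) as [H|H]; apply boolp.asboolW in H; auto.
    + exists t; intros s Cs; apply boolp.asboolT, Hu, Cs.
  - exists t; intros s Hs.
    apply boolp.asboolW, Hm, boolp.asboolT, Hs.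
Qed.

Lemma cle_refl X : cle X X.
Proof. exists (fun x => x); auto. Qed.

Lemma cle_trans X Y W : cle X Y -> cle Y W -> cle X W.
Proof.
  intros [f Hf] [g Hg]; exists (fun x => g (f x)); auto.
Qed.

Lemma cle_sig {X} (P : X -> Prop) : cle {x | P x} X.
Proof. exists (@proj1_sig _ _); intros; now apply sig_eq. Qed.

Lemma cle_sub {X Y} (P : X -> Prop) (Q : Y -> Prop) (f : X -> Y) :
  (forall x, P x -> Q (f x)) ->
  (forall x y, P x -> P y -> f x = f y -> x = y) ->
  cle {x | P x} {y | Q y}.
Proof.
  intros HPQ Hf.
  exists (fun a => exist Q (f (proj1_sig a)) (HPQ _ (proj2_sig a))).
  intros [a pa] [b pb] E; apply sig_eq; simpl.
  injection E; auto.
Qed.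

Lemma cle_incl {X} (P Q : X -> Prop) :
  (forall x, P x -> Q x) -> cle {x | P x} {x | Q x}.
Proof. intros H; apply (cle_sub P Q (fun x => x)); auto. Qed.

Lemma cle_prod X Y X' Y' : cle X X' -> cle Y Y' -> cle (X * Y) (X' * Y').
Proof.
  intros [f Hf] [g Hg]; exists (fun p => (f (fst p), g (snd p))).
  intros [a b] [c d]; simpl; intros [= E1 E2]; f_equal; auto.
Qed.

Lemma cle_sum X Y X' Y' : cle X X' -> cle Y Y' -> cle (X + Y) (X' + Y').
Proof.
  intros [f Hf] [g Hg].
  exists (fun p => match p with inl a => inl (f a) | inr b => inr (g b) end).
  intros [a|a] [b|b] [= E]; f_equal; auto.
Qed.

(** Zorn's lemma on the partial injections from [X] to [Y], ordered by extension: a maximal one is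
    total or onto, as otherwise one more pair could be added. *)
Lemma cle_total (X Y : Type) : cle X Y \/ cle Y X.
Proof.
  destruct (classic (inhabited Y)) as [[y0]|HY].
  2: { right; exists (fun y => False_rect X (HY (inhabits y))).
       intros y; destruct (HY (inhabits y)). }
  pose (T := {p : (X -> Prop) * (X -> Y) |
    forall a b, fst p a -> fst p b -> snd p a = snd p b -> a = b}).
  pose (R := fun s t : T => forall a, fst (proj1_sig s) a ->
    fst (proj1_sig t) a /\ snd (proj1_sig t) a = snd (proj1_sig s) a).
  assert (t0 : T).
  { exists ((fun _ => False), fun _ => y0); simpl; tauto. }
  destruct (zorn_preorder t0 R) as [[[S f] Hf] Hmax].
  - intros t a; auto.
  - intros r s t H1 H2 a Ha; destruct (H1 a Ha) as [Hs E1].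
    destruct (H2 a Hs) as [Hs2 E2]; split; congruence.
  - intros C HC.
    destruct (fun_choice (fun a (s : T) =>
      (exists s', C s' /\ fst (proj1_sig s') a) -> C s /\ fst (proj1_sig s) a))
      as [w Hw].
    { intros a; destruct (classic (exists s', C s' /\ fst (proj1_sig s') a))
        as [[s' H]|H]; [exists s'; auto | exists t0; tauto]. }
    pose (U := fun a => exists s', C s' /\ fst (proj1_sig s') a).
    assert (Hval : forall s a, C s -> fst (proj1_sig s) a ->
      snd (proj1_sig (w a)) a = snd (proj1_sig s) a).
    { intros s a Cs Ha; destruct (Hw a) as [Cw Hwa]; [exists s; auto|].
      destruct (HC s (w a) Cs Cw) as [H|H].
      - now destruct (H a Ha).
      - now destruct (H a Hwa) as [_ ->]. }
    assert (HU : forall a b, U a -> U b ->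
      snd (proj1_sig (w a)) a = snd (proj1_sig (w b)) b -> a = b).
    { intros a b [s [Cs Ha]] [t [Ct Hb]].
      rewrite (Hval s a Cs Ha), (Hval t b Ct Hb); intros E.
      destruct (HC s t Cs Ct) as [H|H].
      - destruct (H a Ha) as [Ha' E']; apply (proj2_sig t); congruence.
      - destruct (H b Hb) as [Hb' E']; apply (proj2_sig s); congruence. }
    exists (exist _ (U, fun a => snd (proj1_sig (w a)) a) HU).
    intros s Cs a Ha; simpl; split; [exists s; auto | now apply Hval].
  - destruct (classic (forall a, S a)) as [HS|HS].
    { left; exists f; intros a b; apply Hf; apply HS. }
    apply not_all_ex_not in HS; destruct HS as [a0 Ha0].
    destruct (classic (forall y, exists a, S a /\ f a = y)) as [Hs|Hs].
    { right; apply fun_choice in Hs; destruct Hs as [h Hh].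
      exists h; intros x y E; destruct (Hh x), (Hh y); congruence. }
    exfalso; apply not_all_ex_not in Hs; destruct Hs as [y1 Hy1].
    pose (g := fun a => if excluded_middle_informative (a = a0) then y1 else f a).
    assert (Hg : forall a b, (S a \/ a = a0) -> (S b \/ b = a0) ->
      g a = g b -> a = b).
    { unfold g; intros a b Ha Hb.
      destruct (excluded_middle_informative (a = a0)),
        (excluded_middle_informative (b = a0)); subst; auto; intros E.
      - destruct Hb as [Hb|]; [destruct Hy1; eauto | congruence].
      - destruct Ha as [Ha|]; [destruct Hy1; eauto | congruence].
      - destruct Ha, Hb; try tauto; apply Hf; auto. }
    apply Ha0.
    assert (HR : R (exist _ (S, f) Hf) (exist _ ((fun a => S a \/ a = a0), g) Hg)).
    { intros a Ha; simpl in *; split; auto; unfold g.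
      destruct (excluded_middle_informative (a = a0)); subst; tauto. }
    destruct (Hmax _ HR a0); simpl; auto.
Qed.

Lemma not_cle X Y : ~ cle X Y -> cle Y X.
Proof. destruct (cle_total X Y); tauto. Qed.

Lemma clt_intro X Y : ~ cle Y X -> clt X Y.
Proof. split; auto using not_cle. Qed.

(** Cantor-Bernstein: [Q] consists of the orbits under [g] after [f] of the points outside the range
    of [g]; the bijection is [f] on [Q] and the inverse of [g] elsewhere. *)
Lemma cle_antisym X Y : cle X Y -> cle Y X -> ceq X Y.
Proof.
  intros [f Hf] [g Hg].
  pose (Q := fun x => exists n x0, (~ exists y, g y = x0) /\
    Nat.iter n (fun x => g (f x)) x0 = x).
  assert (Hy : forall x, ~ Q x -> exists y, g y = x).
  { intros x H; apply NNPP; intros H'; apply H; exists 0%nat, x; auto. }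
  destruct (fun_choice (fun x y => (Q x -> y = f x) /\ (~ Q x -> g y = x)))
    as [h Hh].
  { intros x; destruct (classic (Q x)) as [H|H].
    - exists (f x); tauto.
    - destruct (Hy x H) as [y E]; exists y; tauto. }
  assert (Hstep : forall x, Q x -> Q (g (f x))).
  { intros x (n & x0 & H0 & <-); exists (S n), x0; auto. }
  exists h; split.
  - intros x y E; destruct (Hh x) as [Hx1 Hx2], (Hh y) as [Hy1 Hy2].
    destruct (classic (Q x)) as [Qx|Qx], (classic (Q y)) as [Qy|Qy].
    + apply Hf; rewrite <- Hx1, <- Hy1; auto.
    + exfalso; apply Qy; rewrite <- (Hy2 Qy), <- E, (Hx1 Qx); auto.
    + exfalso; apply Qx; rewrite <- (Hx2 Qx), E, (Hy1 Qy); auto.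
    + rewrite <- (Hx2 Qx), <- (Hy2 Qy); congruence.
  - intros y; destruct (classic (Q (g y))) as [(n & x0 & H0 & E)|H].
    + destruct n as [|n]; simpl in E; [destruct H0; eauto|].
      apply Hg in E; exists (Nat.iter n (fun x => g (f x)) x0).
      rewrite (proj1 (Hh _)); auto; exists n, x0; auto.
    + exists (g y); apply Hg; apply (Hh (g y)); auto.
Qed.

(* A maximal [S] carrying an injection [S * S -> S] has the cardinality of [X]:
   otherwise [S] has a copy outside [S], and the injection extends to the union
   of [S] and this copy. *)
Lemma cle_square X : cle nat X -> cle (X * X) X.
Proof.
  intros [i Hi].
  pose (good := fun (S : X -> Prop) (q : X -> X -> X) =>
    (forall n, S (i n)) /\ (forall a b, S a -> S b -> S (q a b)) /\
    (forall a b c d, S a -> S b -> S c -> S d ->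
       q a b = q c d -> a = c /\ b = d)).
  pose (T := {p : (X -> Prop) * (X -> X -> X) | good (fst p) (snd p)}).
  pose (car := fun t : T => fst (proj1_sig t)).
  pose (op := fun t : T => snd (proj1_sig t)).
  pose (R := fun s t : T => forall a, car s a ->
    car t a /\ forall b, car s b -> op t a b = op s a b).
  assert (Ht0 : inhabited T).
  (* The starting point is the range of [i] with Cantor's pairing, read off through a left inverse
     [j] of [i]. *)
  { destruct (fun_choice (fun x n => (exists m, i m = x) -> i n = x)) as [j Hj].
    { intros x; destruct (classic (exists m, i m = x)) as [[m H]|H].
      - exists m; auto.
      - exists 0%nat; tauto. }
    assert (Hji : forall n, j (i n) = n) by (intros n; apply Hi, Hj; eauto).
    constructor; exists ((fun x => exists n, i n = x),
            fun x y => i (Cantor.to_nat (j x, j y))).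
    split; [|split]; cbn [fst snd].
    - eauto.
    - eauto.
    - intros a b c d [a' <-] [b' <-] [c' <-] [d' <-] E.
      rewrite !Hji in E; apply Hi, Cantor.to_nat_inj in E.
      injection E; intros; split; congruence. }
  destruct Ht0 as [t0].
  destruct (zorn_preorder t0 R) as [[[S q] HSq] Hmax].
  - intros t a Ha; auto.
  - intros r s t H1 H2 a Ha; destruct (H1 a Ha) as [Hs E1].
    destruct (H2 a Hs) as [Ht E2]; split; auto.
    intros b Hb; rewrite E2, E1; auto; apply H1; auto.
  - intros C HC.
    destruct (classic (exists s, C s)) as [[s0 Cs0]|Hne].
    2: { exists t0; intros s Cs; destruct Hne; eauto. }
    pose (U := fun a => exists s, C s /\ car s a).
    assert (Hjoin : forall s t, C s -> C t ->
      exists r, C r /\ (forall a, car s a -> car r a) /\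
                (forall a, car t a -> car r a)).
    { intros s t Cs Ct; destruct (HC s t Cs Ct) as [H|H].
      - exists t; split; [auto|]; split; auto; intros a Ha; now apply H.
      - exists s; split; [auto|]; split; auto; intros a Ha; now apply H. }
    assert (Hjoin2 : forall a b, U a -> U b ->
      exists r, C r /\ car r a /\ car r b).
    { intros a b [s [Cs Ha]] [t [Ct Hb]].
      destruct (Hjoin s t Cs Ct) as (r & Cr & H1 & H2); exists r; auto. }
    destruct (fun_choice (fun (p : X * X) (s : T) =>
      U (fst p) -> U (snd p) -> C s /\ car s (fst p) /\ car s (snd p)))
      as [w Hw].
    { intros [a b]; simpl; destruct (classic (U a /\ U b)) as [[Ha Hb]|H].
      - destruct (Hjoin2 a b Ha Hb) as [r Hr]; eauto.
      - exists t0; tauto. }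
    assert (Hval : forall s a b, C s -> car s a -> car s b ->
      op (w (a, b)) a b = op s a b).
    { intros s a b Cs Ha Hb.
      destruct (Hw (a, b)) as (Cw & Hwa & Hwb); simpl in *; [exists s; auto..|].
      destruct (HC s (w (a, b)) Cs Cw) as [H|H].
      - destruct (H a Ha) as [_ E]; auto.
      - destruct (H a Hwa) as [_ E]; symmetry; auto. }
    assert (HU : good U (fun a b => op (w (a, b)) a b)).
    { split; [|split].
      - intros n; exists s0; split; auto; apply (proj2_sig s0).
      - intros a b Ha Hb; destruct (Hjoin2 a b Ha Hb) as (r & Cr & Hra & Hrb).
        rewrite (Hval r); auto; exists r; split; auto.
        destruct (proj2_sig r) as (_ & Hcl & _); apply Hcl; auto.
      - intros a b c d Ha Hb Hc Hd.
        destruct (Hjoin2 a b Ha Hb) as (r & Cr & Hra & Hrb).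
        destruct (Hjoin2 c d Hc Hd) as (s & Cs & Hsc & Hsd).
        destruct (Hjoin r s Cr Cs) as (t & Ct & Hrt & Hst).
        rewrite (Hval t), (Hval t); auto.
        apply (proj2_sig t);
          first [apply Hrt; assumption | apply Hst; assumption]. }
    exists (exist (fun p => good (fst p) (snd p)) (U, _) HU).
    intros s Cs a Ha; split; [exists s; auto|].
    intros b Hb; apply Hval; auto.
  - destruct HSq as (Hin & Hcl & Hinj) eqn:EHSq; simpl in Hin, Hcl, Hinj.
    destruct (cle_total {x | ~ S x} {x | S x}) as [[h Hh]|[h Hh]].
    (* If the complement of [S] embeds in [S], then all of [X] does: the first component, [i 0] or
       [i 1], tells the points of [S] from the others. *)
    + destruct (fun_choice (fun x y => S y /\
        ((S x -> y = q (i 0%nat) x) /\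
         forall H : ~ S x, y = q (i 1%nat) (proj1_sig (h (exist _ x H))))))
        as [j Hj].
      { intros x; destruct (classic (S x)) as [H|H].
        - exists (q (i 0%nat) x); split; [apply Hcl; auto|].
          split; [auto | contradiction].
        - exists (q (i 1%nat) (proj1_sig (h (exist _ x H)))).
          split; [apply Hcl; auto; apply proj2_sig|split; [contradiction|]].
          intros H'; do 3 f_equal; apply sig_eq; reflexivity. }
      assert (Hji : forall x y, j x = j y -> x = y).
      { intros x y E; destruct (Hj x) as (_ & Hx1 & Hx2), (Hj y) as (_ & Hy1 & Hy2).
        assert (H01 : i 0%nat <> i 1%nat) by (intros H; now apply Hi in H).
        destruct (classic (S x)) as [Sx|Sx], (classic (S y)) as [Sy|Sy].
        - rewrite Hx1, Hy1 in E by auto; apply Hinj in E; tauto || auto.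
        - rewrite Hx1, (Hy2 Sy) in E by auto.
          apply Hinj in E; auto; [|apply proj2_sig].
          destruct E as [E _]; congruence.
        - rewrite (Hx2 Sx), Hy1 in E by auto.
          apply Hinj in E; auto; [|apply proj2_sig].
          destruct E as [E _]; congruence.
        - rewrite (Hx2 Sx), (Hy2 Sy) in E.
          apply Hinj in E; auto; try apply proj2_sig.
          destruct E as [_ E]; apply sig_eq, Hh in E.
          now injection E. }
      exists (fun p => q (j (fst p)) (j (snd p))).
      intros [a b] [c d] E; simpl in E; apply Hinj in E; try apply Hj.
      destruct E; f_equal; auto.
    + exfalso.
      pose (cp := fun a b => exists H : S a, b = proj1_sig (h (exist _ a H))).
      assert (cp_out : forall a b, cp a b -> ~ S b).
      { intros a b [H ->]; exact (proj2_sig (h (exist _ a H))). }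
      assert (cp_in : forall a b, cp a b -> S a) by (intros a b [H _]; auto).
      assert (cp_ex : forall a, S a -> exists b, cp a b).
      { intros a H; exists (proj1_sig (h (exist _ a H))); exists H; auto. }
      assert (cp_fun : forall a b b', cp a b -> cp a b' -> b = b').
      { intros a b b' [H ->] [H' ->]; do 2 f_equal; apply sig_eq; auto. }
      assert (cp_inj : forall a a' b, cp a b -> cp a' b -> a = a').
      { intros a a' b [H ->] [H' E]; apply sig_eq, Hh in E; now injection E. }
      pose (V := fun b => S b \/ exists a, cp a b).
      destruct (fun_choice (fun b a => V b -> S a /\ (S b -> a = b) /\
        (~ S b -> cp a b))) as [rho Hrho].
      { intros b; destruct (classic (S b)) as [H|H].
        - exists b; tauto.
        - destruct (classic (exists a, cp a b)) as [[a Ha]|H'].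
          + exists a; intros _; split; [eapply cp_in; eauto | tauto].
          + exists b; unfold V; tauto. }
      pose (tag := fun a =>
        i (if excluded_middle_informative (S a) then 0%nat else 1%nat)).
      assert (Htag : forall a c, tag a = tag c -> (S a <-> S c)).
      { unfold tag; intros a c E; apply Hi in E.
        destruct (excluded_middle_informative (S a)),
          (excluded_middle_informative (S c)); try tauto; discriminate. }
      assert (Hrt : forall a c, V a -> V c -> tag a = tag c -> rho a = rho c ->
        a = c).
      { intros a c Va Vc Et Er; apply Htag in Et.
        destruct (Hrho a Va) as (_ & A1 & A2), (Hrho c Vc) as (_ & C1 & C2).
        destruct (classic (S a)) as [Sa|Sa].
        - rewrite A1, C1 in Er by tauto; auto.
        - apply (cp_fun (rho a)); [auto|rewrite Er; tauto]. }
      (* A pair in [V] is determined by the tags and the originals in [S] of its components. [code]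
         packs these four points into one; the copy of this point outside [S] is the new value, so
         it cannot collide with a value of [q]. *)
      pose (code := fun a b => q (q (tag a) (tag b)) (q (rho a) (rho b))).
      assert (Hcode : forall a b, V a -> V b -> S (code a b)).
      { intros a b Va Vb; destruct (Hrho a Va), (Hrho b Vb).
        unfold code; repeat apply Hcl; auto; apply Hin. }
      destruct (fun_choice (fun (p : X * X) y => V (fst p) -> V (snd p) ->
        (S (fst p) /\ S (snd p) -> y = q (fst p) (snd p)) /\
        (~ (S (fst p) /\ S (snd p)) -> cp (code (fst p) (snd p)) y)))
        as [q' Hq'].
      { intros [a b]; simpl; destruct (classic (S a /\ S b)) as [H|H].
        - exists (q a b); tauto.
        - destruct (classic (V a /\ V b)) as [[Va Vb]|H'].
          + destruct (cp_ex _ (Hcode a b Va Vb)) as [y Hy]; exists y; tauto.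
          + exists a; tauto. }
      assert (Hg : good V (fun a b => q' (a, b))).
      { split; [|split].
        - intros n; left; auto.
        - intros a b Va Vb; destruct (Hq' (a, b) Va Vb) as [H1 H2]; simpl in *.
          destruct (classic (S a /\ S b)) as [H|H].
          + left; rewrite H1; auto; apply Hcl; tauto.
          + right; eauto.
        - intros a b c d Va Vb Vc Vd E.
          destruct (Hq' (a, b) Va Vb) as [A1 A2], (Hq' (c, d) Vc Vd) as [C1 C2].
          simpl in *.
          destruct (classic (S a /\ S b)) as [H|H],
            (classic (S c /\ S d)) as [H'|H'].
          + rewrite A1, C1 in E by auto; apply Hinj in E; tauto || auto.
          + exfalso; apply (cp_out _ _ (C2 H')); rewrite <- E, A1 by auto.
            apply Hcl; tauto.
          + exfalso; apply (cp_out _ _ (A2 H)); rewrite E, C1 by auto.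
            apply Hcl; tauto.
          + specialize (A2 H); specialize (C2 H'); rewrite E in A2.
            assert (Ec : code a b = code c d) by (eapply cp_inj; eauto).
            destruct (Hrho a Va), (Hrho b Vb), (Hrho c Vc), (Hrho d Vd).
            apply Hinj in Ec; try (apply Hcl; auto; apply Hin).
            destruct Ec as [Et Er].
            apply Hinj in Et; try apply Hin.
            apply Hinj in Er; auto.
            destruct Et, Er; split; apply Hrt; auto. }
      destruct (cp_ex (i 0%nat) (Hin 0%nat)) as [z Hz].
      apply (cp_out _ _ Hz).
      pose (s := exist (fun p => good (fst p) (snd p))
        (V, fun a b => q' (a, b)) Hg : T).
      assert (HV : V z) by (right; eauto).
      refine (proj1 (Hmax s _ z HV)).
      intros a Ha; simpl in *; split; [left; auto|].
      intros b Hb; simpl in *.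
      apply (Hq' (a, b)); simpl; auto; left; auto.
Qed.

Lemma cle_prod_nat X : cle nat X -> cle (X * nat) X.
Proof.
  intros H; eapply cle_trans; [|apply cle_square, H].
  apply cle_prod; auto using cle_refl.
Qed.

Lemma cle_double X : cle nat X -> cle (X + X) X.
Proof.
  intros H; eapply cle_trans; [|apply cle_prod_nat, H].
  exists (fun s => match s with inl x => (x, 0%nat) | inr x => (x, 1%nat) end).
  intros [x|x] [y|y] [= E]; congruence.
Qed.

Lemma cle_sum_inl X Y : cle X (X + Y).
Proof. exists inl; congruence. Qed.

Lemma cle_sum_inr X Y : cle Y (X + Y).
Proof. exists inr; congruence. Qed.

Lemma cle_list X : cle nat X -> cle (list X) X.
Proof.
  intros H; destruct (cle_square X H) as [p Hp].
  eapply cle_trans; [|apply cle_prod_nat, H].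
  destruct H as [i _].
  pose (code := fold_right (fun x c => p (x, c)) (i 0%nat)).
  exists (fun w => (code w, length w)).
  intros v; induction v as [|x v IH]; intros [|y w]; try discriminate; auto.
  simpl; intros [= E1 E2]; apply Hp in E1; injection E1 as -> E1.
  f_equal; apply IH; congruence.
Qed.

Lemma cle_Z_nat : cle Z nat.
Proof.
  exists (fun z => Z.to_nat (if z <? 0 then -2 * z - 1 else 2 * z)).
  intros x y; destruct (Z.ltb_spec x 0), (Z.ltb_spec y 0); lia.
Qed.

(** The larger summand absorbs the smaller one if it is infinite; otherwise the sum is countable. *)
Lemma not_cle_sum B X Y :
  ~ cle B nat -> ~ cle B X -> ~ cle B Y -> ~ cle B (X + Y).
Proof.
  assert (Hwlog : forall X Y, ~ cle B nat -> ~ cle B Y -> cle X Y ->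
    ~ cle B (X + Y)).
  { clear; intros X Y Hn HY HXY HB.
    destruct (cle_total nat Y) as [H|H].
    - apply HY; eapply cle_trans; [exact HB|].
      eapply cle_trans; [|apply cle_double, H].
      apply cle_sum; auto using cle_refl.
    - apply Hn; eapply cle_trans; [exact HB|].
      eapply cle_trans; [|apply cle_double, cle_refl].
      apply cle_sum; eauto using cle_trans. }
  intros Hn HX HY HB; destruct (cle_total X Y) as [H|H].
  - exact (Hwlog X Y Hn HY H HB).
  - apply (Hwlog Y X Hn HX H); eapply cle_trans; [exact HB|].
    exists (fun s => match s with inl x => inr x | inr y => inl y end).
    intros [x|x] [y|y] [= E]; congruence.
Qed.

(** A point is coded by its fiber and its image under a chosen injection of that fiber into [M]. *)
Lemma cle_fibers {X C} M (t : X -> C) :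
  (forall c, cle {x | t x = c} M) -> cle X (M * C).
Proof.
  intros H.
  destruct (fun_choice (fun c (f : X -> M) => forall x y, t x = c -> t y = c ->
    f x = f y -> x = y)) as [f Hf].
  { intros c; destruct (H c) as [f Hf].
    destruct (classic (exists x0, t x0 = c)) as [[x0 H0]|Hne].
    2: { destruct (classic (inhabited M)) as [[m]|HM].
         - exists (fun _ => m); intros x y Hx; destruct Hne; eauto.
         - destruct (classic (inhabited X)) as [[x]|HX].
           + exfalso; apply HM; destruct (H (t x)) as [g _].
             exact (inhabits (g (exist _ x eq_refl))).
           + exists (fun x => False_rect M (HX (inhabits x))).
             intros x; destruct (HX (inhabits x)). }
    exists (fun x => match excluded_middle_informative (t x = c) with
      | left Hx => f (exist _ x Hx) | right _ => f (exist _ x0 H0) end).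
    intros x y Hx Hy.
    destruct (excluded_middle_informative (t x = c)); [|tauto].
    destruct (excluded_middle_informative (t y = c)); [|tauto].
    intros E; apply Hf in E; now injection E. }
  exists (fun x => (f (t x) x, t x)).
  intros x y [= E1 E2]; apply (Hf (t x)); congruence.
Qed.

(** The indices [m i] increase, each one past the last occurrence of all values taken earlier. *)
Lemma cle_nat_finite_to_one {Y} (h : nat -> Y) :
  (forall y, exists N, forall n, (N <= n)%nat -> h n <> y) -> cle nat Y.
Proof.
  intros H; apply fun_choice in H; destruct H as [N HN].
  pose (m := nat_rec (fun _ => nat) 0%nat
    (fun _ m => Nat.max (S m) (N (h m)))).
  assert (HS : forall i, m (S i) = Nat.max (S (m i)) (N (h (m i))))
    by reflexivity.
  assert (Hm : forall i j, (i < j)%nat ->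
    (m i < m j)%nat /\ (N (h (m i)) <= m j)%nat).
  { intros i j Hij; induction Hij as [|j Hij IH]; rewrite HS; lia. }
  exists (fun i => h (m i)); intros i j E.
  destruct (Nat.lt_trichotomy i j) as [Hij|[Hij|Hij]]; auto; exfalso.
  - apply (HN (h (m i)) (m j)); [now apply Hm | auto].
  - apply (HN (h (m j)) (m i)); [now apply Hm | auto].
Qed.

(** An injection into [nat] must be bounded here, since points with larger and larger images would
    form a finite-to-one sequence. *)
Lemma finite_enum X : ~ cle nat X -> exists w : list X, forall x, In x w.
Proof.
  intros Hn; destruct (not_cle _ _ Hn) as [f Hf].
  assert (HN : exists N, forall x, (f x < N)%nat).
  { apply NNPP; intros H; apply Hn.
    destruct (fun_choice (fun N x => (N <= f x)%nat)) as [h Hh].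
    { intros N; apply NNPP; intros H'; apply H; exists N; intros x.
      apply NNPP; intros Hx; apply H'; exists x; lia. }
    apply (cle_nat_finite_to_one h); intros y; exists (S (f y)).
    intros n Hle E; specialize (Hh n); rewrite E in Hh; lia. }
  destruct HN as [N HN].
  assert (Hk : forall k, exists w : list X, forall x, (f x < k)%nat -> In x w).
  { induction k as [|k [w Hw]]; [exists nil; lia|].
    destruct (classic (exists x, f x = k)) as [[x0 H0]|H0].
    - exists (x0 :: w); intros x Hx; destruct (Nat.eq_dec (f x) k) as [E|E].
      + left; apply Hf; congruence.
      + right; apply Hw; lia.
    - exists w; intros x Hx; apply Hw.
      enough (f x <> k) by lia; eauto. }
  destruct (Hk N) as [w Hw]; eauto.
Qed.

Lemma finite_sig_enum {X} (P : X -> Prop) : ~ cle nat {x | P x} ->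
  exists w : list X, NoDup w /\ forall x, In x w <-> P x.
Proof.
  intros H; destruct (finite_enum _ H) as [w Hw].
  exists (nodup (fun x y => excluded_middle_informative (x = y))
            (map (@proj1_sig _ _) w)).
  split; [apply NoDup_nodup|]; intros x; rewrite nodup_In, in_map_iff; split.
  - intros [[y Hy] [<- _]]; auto.
  - intros Hx; exists (exist _ x Hx); auto.
Qed.

(** * Specker's theorem *)

Definition additive {D : Type} (phi : (D -> Z) -> Z) : Prop :=
  forall x y, phi (fun d => x d + y d) = phi x + phi y.

Definition restr {D : Type} (P : D -> Prop) (x : D -> Z) : D -> Z :=
  fun d => if excluded_middle_informative (P d) then x d else 0.

Definition delta {D : Type} (k : D) : D -> Z := restr (eq k) (fun _ => 1).

Lemma restr_in {D} (P : D -> Prop) x d : P d -> restr P x d = x d.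
Proof. unfold restr; destruct (excluded_middle_informative (P d)); tauto. Qed.

Lemma restr_out {D} (P : D -> Prop) x d : ~ P d -> restr P x d = 0.
Proof. unfold restr; destruct (excluded_middle_informative (P d)); tauto. Qed.

Lemma restr_add {D} (P : D -> Prop) x y :
  restr P (fun d => x d + y d) = (fun d => restr P x d + restr P y d).
Proof.
  extensionality d; unfold restr.
  destruct (excluded_middle_informative (P d)); lia.
Qed.

Lemma restr_split {D} (P : D -> Prop) x :
  x = (fun d => restr P x d + restr (fun d => ~ P d) x d).
Proof.
  extensionality d; unfold restr.
  destruct (excluded_middle_informative (P d)),
    (excluded_middle_informative (~ P d)); tauto || lia.
Qed.

Lemma delta_same {D} (k : D) : delta k k = 1.
Proof. exact (restr_in (eq k) (fun _ => 1) k eq_refl). Qed.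

Lemma delta_other {D} (k d : D) : k <> d -> delta k d = 0.
Proof. exact (restr_out (eq k) (fun _ => 1) d). Qed.

Lemma additive_0 {D} (phi : (D -> Z) -> Z) :
  additive phi -> phi (fun _ => 0) = 0.
Proof.
  intros H; specialize (H (fun _ => 0) (fun _ => 0)); simpl in H; lia.
Qed.

Lemma additive_scale {D} (phi : (D -> Z) -> Z) c x :
  additive phi -> phi (fun d => c * x d) = c * phi x.
Proof.
  intros H.
  assert (Hn : forall n, phi (fun d => Z.of_nat n * x d) = Z.of_nat n * phi x).
  { induction n as [|n IH].
    - exact (additive_0 phi H).
    - rewrite Nat2Z.inj_succ; unfold Z.succ.
      rewrite Z.mul_add_distr_r, <- IH, Z.mul_1_l, <- H; f_equal.
      extensionality d; lia. }
  destruct (Z_le_gt_dec 0 c) as [Hc|Hc].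
  - rewrite <- (Z2Nat.id c Hc); apply Hn.
  - pose proof (H (fun d => c * x d) (fun d => Z.of_nat (Z.to_nat (- c)) * x d))
      as E; simpl in E; rewrite Hn in E.
    rewrite Z2Nat.id in E by lia.
    replace (fun d => c * x d + - c * x d) with (fun _ : D => 0) in E
      by (extensionality d; lia).
    rewrite (additive_0 phi H) in E; lia.
Qed.

Lemma additive_delta {D} (phi : (D -> Z) -> Z) c k :
  additive phi -> phi (restr (eq k) (fun _ => c)) = c * phi (delta k).
Proof.
  intros H; rewrite <- additive_scale by auto; f_equal.
  extensionality d; unfold delta, restr.
  destruct (excluded_middle_informative (k = d)); lia.
Qed.

Lemma not_cle_powerset_nat : ~ cle (nat -> Prop) nat.
Proof.
  intros [F HF].
  pose (S := fun n => exists T, F T = n /\ ~ T n).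
  assert (H : S (F S) <-> ~ S (F S)); [|tauto].
  split.
  - intros [T [E HT]]; apply HF in E; subst T; auto.
  - intros H; exists S; auto.
Qed.

(* If no [psi (delta n)] vanished, then [psi] would be injective on the
   uncountable set of the functions with values [x n] in [{0, d n}], as the
   weights [d] grow so fast that [d (n + 1)] does not divide [d n * psi (delta n)]. *)
Lemma specker_vanish_once (psi : (nat -> Z) -> Z) :
  additive psi -> exists n, psi (delta n) = 0.
Proof.
  intros Hadd; apply NNPP; intros Hno.
  assert (Hc : forall n, psi (delta n) <> 0) by eauto.
  clear Hno.
  pose (d := nat_rec (fun _ => Z) 1
    (fun n dn => dn * (2 * Z.abs (psi (delta n))))).
  assert (dS : forall n, d (S n) = d n * (2 * Z.abs (psi (delta n))))
    by reflexivity.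
  assert (dpos : forall n, 0 < d n).
  { induction n as [|n IH]; [reflexivity|rewrite dS; specialize (Hc n); nia]. }
  assert (ddvd : forall n m, (n <= m)%nat -> (d n | d m)).
  { intros n m Hle; induction Hle; [apply Z.divide_refl|].
    rewrite dS; now apply Z.divide_mul_l. }
  apply not_cle_powerset_nat.
  eapply cle_trans; [|exact cle_Z_nat].
  exists (fun S => psi (restr S d)).
  intros S T E; apply NNPP; intros Hne.
  assert (Hex : exists n, ~ (S n <-> T n)).
  { apply NNPP; intros H; apply Hne; extensionality n.
    apply propositional_extensionality, NNPP; eauto. }
  assert (Hmin : exists n, ~ (S n <-> T n) /\
    forall m, (m < n)%nat -> (S m <-> T m)).
  { destruct Hex as [n Hn]; induction n as [n IH] using lt_wf_ind.
    destruct (classic (exists m, (m < n)%nat /\ ~ (S m <-> T m)))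
      as [[m [Hm H]]|H]; [eauto|].
    exists n; split; auto; intros m Hm; apply NNPP; eauto. }
  destruct Hmin as [n [Hn Hlt]].
  (* [z] vanishes before the first difference [n], is [d n] up to sign there, and is a multiple of
     [d (n + 1)] afterwards. *)
  pose (z := fun m => restr S d m + -1 * restr T d m).
  assert (Hz : psi z = 0).
  { unfold z; rewrite Hadd, additive_scale by auto; lia. }
  assert (Hzlt : forall m, (m < n)%nat -> z m = 0).
  { intros m Hm; unfold z, restr; specialize (Hlt m Hm).
    destruct (excluded_middle_informative (S m)),
      (excluded_middle_informative (T m)); tauto || lia. }
  assert (Hzn : z n = d n \/ z n = - d n).
  { unfold z, restr; destruct (excluded_middle_informative (S n)),
      (excluded_middle_informative (T n)); tauto || lia. }
  assert (Hzgt : forall m, exists w, (n < m)%nat -> z m = d (Datatypes.S n) * w).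
  { intros m; destruct (le_lt_dec m n) as [Hm|Hm]; [exists 0; lia|].
    destruct (ddvd (Datatypes.S n) m Hm) as [w Hw].
    unfold z, restr; destruct (excluded_middle_informative (S m)),
      (excluded_middle_informative (T m));
      [exists 0 | exists w | exists (- w) | exists 0]; lia. }
  apply fun_choice in Hzgt; destruct Hzgt as [w Hw].
  assert (Ez : z = fun m => restr (eq n) (fun _ => z n) m +
    d (Datatypes.S n) * restr (fun m => (n < m)%nat) w m).
  { extensionality m.
    destruct (Nat.lt_trichotomy m n) as [H|[->|H]].
    - rewrite !restr_out by lia; rewrite Hzlt by lia; lia.
    - rewrite restr_in, restr_out by lia; lia.
    - rewrite restr_out, restr_in by lia; rewrite Hw by lia; lia. }
  rewrite Ez, Hadd, additive_delta, additive_scale in Hz by auto.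
  rewrite dS in Hz; specialize (Hc n); specialize (dpos n).
  set (p := psi (restr (fun m => (n < m)%nat) w)) in *.
  set (c := psi (delta n)) in *.
  assert (Hz' : d n * (c + 2 * Z.abs c * p) = 0 \/ d n * (c - 2 * Z.abs c * p) = 0).
  { destruct Hzn as [E'|E']; rewrite E' in Hz; [left|right]; lia. }
  (* The factor 2 in the weights leaves an odd cofactor of [c], which cannot vanish. *)
  assert (Hcc : exists r, c * (1 + 2 * r) = 0).
  { destruct Hz' as [H|H]; apply Z.mul_eq_0 in H; destruct H as [H|H]; try lia;
      destruct (Z.abs_eq_or_opp c) as [A|A]; rewrite A in H;
      [exists p | exists (- p) | exists (- p) | exists p]; lia. }
  destruct Hcc as [r Hr]; apply Z.mul_eq_0 in Hr; lia.
Qed.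

(** Otherwise infinitely many blocks [t = n] have nonzero value. Spreading a sequence over these
    blocks, as a factor of [y], gives an additive map on sequences that kills no unit vector. *)
Lemma specker_eventually {D} (phi : (D -> Z) -> Z) (t : D -> nat) (y : D -> Z) :
  additive phi ->
  exists N, forall n, (N <= n)%nat -> phi (restr (fun d => t d = n) y) = 0.
Proof.
  intros Hadd; apply NNPP; intros Hno.
  destruct (fun_choice (fun N n => (N <= n)%nat /\
    phi (restr (fun d => t d = n) y) <> 0)) as [h0 Hh0].
  { intros N; apply NNPP; intros H; apply Hno; exists N; intros n Hn.
    apply NNPP; eauto. }
  assert (Hinf : cle nat {n | phi (restr (fun d => t d = n) y) <> 0}).
  { apply (cle_nat_finite_to_one (fun N => exist _ (h0 N) (proj2 (Hh0 N)))).
    intros [m Hm]; exists (S m); intros n Hn [= E].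
    destruct (Hh0 n); lia. }
  destruct Hinf as [h Hh].
  (* [t'] numbers the selected blocks. Outside them it is arbitrary, and [y'] is zero. *)
  destruct (fun_choice (fun d i => (exists j, proj1_sig (h j) = t d) ->
    proj1_sig (h i) = t d)) as [t' Ht'].
  { intros d; destruct (classic (exists j, proj1_sig (h j) = t d)) as [[j H]|H];
      [exists j; auto | exists 0%nat; tauto]. }
  pose (U := fun d => exists j, proj1_sig (h j) = t d).
  pose (y' := restr U y).
  destruct (specker_vanish_once (fun a => phi (fun d => a (t' d) * y' d)))
    as [n Hn].
  { intros a b; rewrite <- Hadd; f_equal; extensionality d; lia. }
  apply (proj2_sig (h n)); rewrite <- Hn; f_equal; extensionality d.
  unfold y'; destruct (classic (U d)) as [H|H].
  - rewrite (restr_in U y d H); specialize (Ht' d H).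
    destruct (classic (n = t' d)) as [->|E].
    + rewrite restr_in, delta_same by auto; lia.
    + rewrite delta_other, restr_out; auto.
      intros E'; apply E, Hh, sig_eq; congruence.
  - rewrite (restr_out U y d H), restr_out; [lia|intros E; apply H; exists n; auto].
Qed.

Fixpoint zsum (f : nat -> Z) (N : nat) : Z :=
  match N with O => 0 | S n => zsum f n + f n end.

Lemma additive_head (psi : (nat -> Z) -> Z) a N : additive psi ->
  psi (restr (fun m => (m < N)%nat) a) = zsum (fun m => a m * psi (delta m)) N.
Proof.
  intros Hadd; induction N as [|N IH]; simpl.
  - rewrite <- (additive_0 psi Hadd); f_equal; extensionality m.
    apply restr_out; lia.
  - rewrite <- IH, <- additive_delta, <- Hadd by auto; f_equal.
    extensionality m; destruct (Nat.lt_trichotomy m N) as [H|[->|H]].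
    + rewrite restr_in, restr_in, restr_out by lia; lia.
    + rewrite restr_in, restr_out, restr_in by lia; lia.
    + rewrite !restr_out by lia; lia.
Qed.

Lemma zsum_0 f N : (forall m, f m = 0) -> zsum f N = 0.
Proof. intros H; induction N; simpl; rewrite ?H; lia. Qed.

(** The first [n] entries contribute nothing and the others share the factor [q ^ n], so every power
    of [q] divides [psi x]. *)
Lemma specker_divisible (psi : (nat -> Z) -> Z) q x : additive psi ->
  (forall n, psi (delta n) = 0) -> 1 < q ->
  (forall n, (q ^ Z.of_nat n | x n)) -> psi x = 0.
Proof.
  intros Hadd H0 Hq Hx.
  assert (Hdvd : forall n, (q ^ Z.of_nat n | psi x)).
  { intros n.
    assert (Hw : forall m, exists w, (n <= m)%nat -> x m = q ^ Z.of_nat n * w).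
    { intros m; destruct (le_lt_dec n m) as [Hm|Hm]; [|exists 0; lia].
      destruct (Hx m) as [w Hw]; exists (w * q ^ Z.of_nat (m - n)); intros _.
      rewrite Hw; replace (Z.of_nat m) with (Z.of_nat n + Z.of_nat (m - n)) by lia.
      rewrite Z.pow_add_r by lia; ring. }
    apply fun_choice in Hw; destruct Hw as [w Hw].
    exists (psi (restr (fun m => ~ (m < n)%nat) w)).
    rewrite (restr_split (fun m => (m < n)%nat) x), Hadd, additive_head by auto.
    rewrite zsum_0 by (intros m; rewrite H0; lia).
    rewrite Z.mul_comm, <- additive_scale by auto; simpl; f_equal.
    extensionality m; destruct (le_lt_dec n m) as [Hm|Hm].
    - rewrite !restr_in by lia; apply Hw, Hm.
    - rewrite !restr_out by lia; lia. }
  apply NNPP; intros Hne.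
  specialize (Hdvd (Z.to_nat (Z.abs (psi x)))).
  apply Z.divide_abs_r in Hdvd; apply Z.divide_pos_le in Hdvd; [|lia].
  pose proof (Z.pow_gt_lin_r q (Z.of_nat (Z.to_nat (Z.abs (psi x)))) Hq).
  rewrite Z2Nat.id in * by lia; lia.
Qed.

(* Every [x] is the sum of a function with [x n] divisible by [2 ^ n] and one
   with [x n] divisible by [3 ^ n]. *)
Lemma specker_zero (psi : (nat -> Z) -> Z) x : additive psi ->
  (forall n, psi (delta n) = 0) -> psi x = 0.
Proof.
  intros Hadd H0.
  assert (Hb : forall n, exists uv : Z * Z,
    fst uv * 2 ^ Z.of_nat n + snd uv * 3 ^ Z.of_nat n = 1).
  { intros n; destruct (rel_prime_bezout (2 ^ Z.of_nat n) (3 ^ Z.of_nat n))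
      as [u v E].
    - apply rel_prime_Zpower; try lia.
      apply bezout_rel_prime, (Bezout_intro _ _ _ (-1) 1); lia.
    - exists (u, v); auto. }
  apply fun_choice in Hb; destruct Hb as [uv Huv].
  replace x with (fun n => x n * fst (uv n) * 2 ^ Z.of_nat n +
                           x n * snd (uv n) * 3 ^ Z.of_nat n).
  - rewrite Hadd, (specker_divisible _ 2), (specker_divisible _ 3); auto; try lia;
      intros n; apply Z.divide_factor_r.
  - extensionality n; rewrite <- (Z.mul_1_r (x n)) at 3.
    rewrite <- (Huv n); ring.
Qed.

(** On the sequences supported from [N] on, [psi] kills all unit vectors and hence, by
    [specker_zero], everything. *)
Lemma specker_expansion (psi : (nat -> Z) -> Z) N a : additive psi ->
  (forall n, (N <= n)%nat -> psi (delta n) = 0) ->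
  psi a = zsum (fun m => a m * psi (delta m)) N.
Proof.
  intros Hadd HN.
  rewrite (restr_split (fun m => (m < N)%nat) a) at 1.
  rewrite Hadd, additive_head by auto.
  rewrite (specker_zero (fun b => psi (restr (fun m => ~ (m < N)%nat) b))).
  - lia.
  - intros b c; rewrite <- Hadd, restr_add; auto.
  - intros n; destruct (le_lt_dec N n) as [Hn|Hn].
    + rewrite <- (HN n Hn); f_equal; extensionality m.
      destruct (classic (m < N)%nat) as [Hm|Hm].
      * rewrite restr_out, delta_other by lia; auto.
      * now rewrite restr_in.
    + rewrite <- (additive_0 psi Hadd); f_equal; extensionality m.
      destruct (classic (m < N)%nat) as [Hm|Hm].
      * now apply restr_out; lia.
      * rewrite restr_in, delta_other by lia; auto.
Qed.

(* The weights grow so fast that the last nonzero entry of [s n] dominates. *)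
Lemma growing_weights (s : nat -> nat -> Z) (N : nat -> nat) :
  (forall n, s n n <> 0) -> (forall n m, (N n <= m)%nat -> s n m = 0) ->
  exists a : nat -> Z, forall n, zsum (fun m => a m * s n m) (N n) <> 0.
Proof.
  intros Hs HN.
  (* [c q] bounds [|s n m|] for [n <= q] and [m < q], and [T q] is the sum of the weights before
     [q]. A sum up to [q] is thus at most [c q * T q], which is just below [a q]. *)
  pose (c := fun q => zsum (fun n => zsum (fun m => Z.abs (s n m)) q) (S q)).
  pose (T := nat_rec (fun _ => Z) 0 (fun q Tq => Tq + (1 + c q * Tq))).
  pose (a := fun q => 1 + c q * T q).
  assert (HT : forall q, T (S q) = T q + a q) by reflexivity.
  assert (Hnn : forall f n, (forall m, 0 <= f m) -> 0 <= zsum f n).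
  { intros f n Hf; induction n; simpl; [lia|specialize (Hf n); lia]. }
  assert (Hle : forall f n m, (forall m, 0 <= f m) -> (m < n)%nat -> f m <= zsum f n).
  { intros f n m Hf; induction n as [|n IH]; simpl; [lia|]; intros Hm.
    destruct (Nat.eq_dec m n) as [->|].
    - specialize (Hnn f n Hf); lia.
    - specialize (Hf n); specialize (IH ltac:(lia)); lia. }
  assert (Habs : forall n q m, (n <= q)%nat -> (m < q)%nat -> Z.abs (s n m) <= c q).
  { intros n q m Hn Hm; unfold c.
    transitivity (zsum (fun m => Z.abs (s n m)) q).
    - apply (Hle (fun m => Z.abs (s n m))); [lia|auto].
    - apply (Hle (fun n => zsum (fun m => Z.abs (s n m)) q)); [|lia].
      intros k; apply Hnn; lia. }
  assert (Hc : forall q, 0 <= c q).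
  { intros q; apply Hnn; intros k; apply Hnn; lia. }
  assert (HTa : forall q, 0 <= T q /\ 0 < a q).
  { induction q as [|q [IH1 IH2]].
    - split; [reflexivity|unfold a; change (T 0%nat) with 0; lia].
    - assert (0 <= T (S q)) by (rewrite HT; lia).
      split; auto; unfold a; specialize (Hc (S q)); nia. }
  assert (Hhead : forall n q, (n <= q)%nat ->
    Z.abs (zsum (fun m => a m * s n m) q) <= c q * T q).
  { intros n q Hnq.
    assert (H : forall r, (r <= q)%nat ->
      Z.abs (zsum (fun m => a m * s n m) r) <= c q * T r).
    { induction r as [|r IH]; intros Hr; cbn [zsum];
        [change (T 0%nat) with 0; lia|].
      rewrite HT; specialize (IH ltac:(lia)).
      specialize (Habs n q r Hnq Hr); destruct (HTa r).
      transitivity (Z.abs (zsum (fun m => a m * s n m) r) + Z.abs (a r * s n r));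
        [lia|].
      rewrite Z.abs_mul, (Z.abs_eq (a r)) by lia.
      assert (a r * Z.abs (s n r) <= a r * c q) by (apply Z.mul_le_mono_nonneg_l; lia).
      lia. }
    auto. }
  exists a; intros n.
  (* Final zeros are dropped until the last nonzero entry is reached; its index is at least [n]
     because [s n n <> 0]. *)
  assert (Hlast : forall M, (n < M)%nat -> (forall m, (M <= m)%nat -> s n m = 0) ->
    zsum (fun m => a m * s n m) M <> 0).
  { induction M as [|q IH]; [lia|]; intros Hq H0; simpl.
    destruct (Z.eq_dec (s n q) 0) as [E|E].
    - rewrite E, Z.mul_0_r, Z.add_0_r; apply IH.
      + destruct (Nat.eq_dec n q) as [->|]; [specialize (Hs q); lia|lia].
      + intros m Hm; destruct (Nat.eq_dec m q) as [->|]; auto; apply H0; lia.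
    - specialize (Hhead n q ltac:(lia)).
      assert (c q * T q < Z.abs (a q * s n q)); [|lia].
      rewrite Z.abs_mul; destruct (HTa q).
      assert (c q * T q < a q) by (unfold a; lia); nia. }
  apply Hlast; auto.
  destruct (le_lt_dec (N n) n) as [H|H]; auto.
  destruct (Hs n); auto.
Qed.

(* Specker's theorem allows to sum the functions [restr (t = n) y] with weights
   chosen so that no cancellation occurs in the coordinates [La n]. *)
Lemma glue_supports {D L} (g : (D -> Z) -> L -> Z) (t : D -> nat) (y : D -> Z)
  (La : nat -> L -> Prop) (s : nat -> nat -> Z) :
  (forall l, additive (fun x => g x l)) ->
  (forall n, exists l, La n l) ->
  (forall n l m, La n l -> g (restr (fun d => t d = m) y) l = s n m) ->
  (forall n, s n n <> 0) ->
  exists x, forall n l, La n l -> g x l <> 0.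
Proof.
  intros Hadd Hne Hs Hd.
  assert (HN : forall n, exists N, forall m, (N <= m)%nat -> s n m = 0).
  { intros n; destruct (Hne n) as [l Hl].
    destruct (specker_eventually (fun x => g x l) t y (Hadd l)) as [N HN].
    exists N; intros m Hm; rewrite <- (Hs n l m Hl); auto. }
  apply fun_choice in HN; destruct HN as [N HN].
  destruct (growing_weights s N Hd HN) as [a Ha].
  exists (fun d => a (t d) * y d); intros n l Hl.
  assert (Hdel : forall m, g (fun d => delta m (t d) * y d) l = s n m).
  { intros m; rewrite <- (Hs n l m Hl); f_equal; extensionality d.
    destruct (classic (t d = m)) as [E|E].
    - rewrite restr_in, <- E, delta_same by auto; lia.
    - rewrite restr_out, delta_other by auto; lia. }
  rewrite (specker_expansion (fun b => g (fun d => b (t d) * y d) l) (N n)).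
  - intros E; apply (Ha n); rewrite <- E.
    f_equal; extensionality m; rewrite Hdel; auto.
  - intros b c; rewrite <- Hadd; f_equal; extensionality d; lia.
  - intros m Hm; rewrite Hdel; auto.
Qed.

(** * Homomorphisms with large image supports *)

(** For additive [phi], the sets that fail this form an ideal, the null sets of [phi]. *)
Definition positive {D : Type} (phi : (D -> Z) -> Z) (S : D -> Prop) : Prop :=
  exists x, (forall d, ~ S d -> x d = 0) /\ phi x <> 0.

(** The positive sets are peeled off one at a time, which builds in their disjointness. An [n] for
    which this fails bounds the rank of [phi] on [S]. *)
Fixpoint antichain {D : Type} (phi : (D -> Z) -> Z) (n : nat) (S : D -> Prop)
    : Prop :=
  match n with
  | O => True
  | Datatypes.S n => exists Y, (forall d, Y d -> S d) /\ positive phi Y /\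
      antichain phi n (fun d => S d /\ ~ Y d)
  end.

Lemma positive_mono {D} (phi : (D -> Z) -> Z) (S T : D -> Prop) :
  (forall d, S d -> T d) -> positive phi S -> positive phi T.
Proof. intros H [x [Hx Hp]]; exists x; split; auto. Qed.

Lemma positive_split {D} (phi : (D -> Z) -> Z) (S T : D -> Prop) :
  additive phi -> positive phi S ->
  positive phi (fun d => S d /\ T d) \/ positive phi (fun d => S d /\ ~ T d).
Proof.
  intros Hadd [x [Hx Hp]].
  rewrite (restr_split T x), Hadd in Hp.
  destruct (Z.eq_dec (phi (restr T x)) 0) as [E|E].
  - right; exists (restr (fun d => ~ T d) x); split; [|lia].
    intros d Hd; destruct (classic (T d)) as [Td|Td].
    + apply restr_out; tauto.
    + rewrite restr_in by auto; apply Hx; tauto.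
  - left; exists (restr T x); split; [|lia].
    intros d Hd; destruct (classic (T d)) as [Td|Td].
    + rewrite restr_in by auto; apply Hx; tauto.
    + apply restr_out; tauto.
Qed.

(** Witnesses on disjoint sets glue to a single function, whose blocks contradict
    [specker_eventually]. *)
Lemma no_infinite_antichain {D} (phi : (D -> Z) -> Z) (Y : nat -> D -> Prop) :
  additive phi ->
  (forall n m d, Y n d -> Y m d -> n = m) ->
  ~ (forall n, positive phi (Y n)).
Proof.
  intros Hadd Hdisj Hpos; apply fun_choice in Hpos; destruct Hpos as [x Hx].
  destruct (fun_choice (fun d n => (exists m, Y m d) -> Y n d)) as [t Ht].
  { intros d; destruct (classic (exists m, Y m d)) as [[m H]|H];
      [exists m; auto | exists 0%nat; tauto]. }
  destruct (specker_eventually phi t (fun d => x (t d) d) Hadd) as [N HN].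
  apply (proj2 (Hx N)); rewrite <- (HN N) by lia; f_equal; extensionality d.
  destruct (classic (t d = N)) as [<-|E].
  - now rewrite restr_in.
  - rewrite restr_out by auto; apply Hx; intros HY; apply E.
    apply (Hdisj _ _ d); [apply Ht|]; eauto.
Qed.

Lemma antichain_mono {D} (phi : (D -> Z) -> Z) n : forall (S T : D -> Prop),
  (forall d, S d -> T d) -> antichain phi n S -> antichain phi n T.
Proof.
  induction n as [|n IH]; simpl; auto; intros S T H (Y & H1 & H2 & H3).
  exists Y; split; [|split]; auto.
  eapply IH; [|exact H3]; simpl; intros d []; auto.
Qed.

(** Pigeonhole: each of the [N] positive sets has a positive part inside [E] or outside [E]. *)
Lemma antichain_split {D} (phi : (D -> Z) -> Z) : additive phi ->
  forall N n m (S E : D -> Prop), (n + m = N)%nat -> antichain phi N S ->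
  antichain phi n (fun d => S d /\ E d) \/ antichain phi m (fun d => S d /\ ~ E d).
Proof.
  intros Hadd; induction N as [|N IH]; intros n m S E Hnm HS.
  { left; replace n with 0%nat by lia; exact I. }
  destruct n as [|n]; [left; exact I|]; destruct m as [|m]; [right; exact I|].
  destruct HS as (Y & H1 & H2 & H3).
  destruct (positive_split phi Y E Hadd H2) as [H|H].
  - destruct (IH n (Datatypes.S m) _ E ltac:(lia) H3) as [H'|H'].
    + left; exists (fun d => Y d /\ E d); split; [firstorder|split; auto].
      eapply antichain_mono; [|exact H']; simpl; tauto.
    + right; eapply antichain_mono; [|exact H']; simpl; tauto.
  - destruct (IH (Datatypes.S n) m _ E ltac:(lia) H3) as [H'|H'].
    + left; eapply antichain_mono; [|exact H']; simpl; tauto.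
    + right; exists (fun d => Y d /\ ~ E d); split; [firstorder|split; auto].
      eapply antichain_mono; [|exact H']; simpl; tauto.
Qed.

(** If a set has arbitrarily long antichains, it can be cut so that one part still has them and the
    other part is positive. Iterating on the former leaves infinitely many disjoint positive
    sets. *)
Lemma antichain_bounded {D} (phi : (D -> Z) -> Z) (S0 : D -> Prop) :
  additive phi -> exists n, ~ antichain phi n S0.
Proof.
  intros Hadd; apply NNPP; intros Hno.
  pose (unb := fun S : D -> Prop => forall n, antichain phi n S).
  assert (Hstep : forall S : {S | unb S}, exists T : {S | unb S},
    (forall d, proj1_sig T d -> proj1_sig S d) /\
    positive phi (fun d => proj1_sig S d /\ ~ proj1_sig T d)).
  { intros [S HS]; simpl.
    (* Cutting along [Y] leaves a positive set on either side: [Y] itself, and [Y2] outside it. *)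
    destruct (HS 2%nat) as (Y & HYS & HY & Y2 & HY2S & HY2 & _).
    assert (Hor : unb (fun d => S d /\ Y d) \/ unb (fun d => S d /\ ~ Y d)).
    { apply NNPP; intros H; apply not_or_and in H; destruct H as [Ha Hb].
      apply not_all_ex_not in Ha, Hb; destruct Ha as [n Ha], Hb as [m Hb].
      destruct (antichain_split phi Hadd _ n m S Y eq_refl (HS _)); tauto. }
    destruct Hor as [H|H].
    - exists (exist _ _ H); simpl; split; [tauto|].
      eapply positive_mono; [|exact HY2]; simpl; intros d Hd.
      specialize (HY2S d Hd); tauto.
    - exists (exist _ _ H); simpl; split; [tauto|].
      eapply positive_mono; [|exact HY]; simpl; intros d Hd.
      specialize (HYS d Hd); tauto. }
  apply fun_choice in Hstep; destruct Hstep as [nx Hnx].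
  assert (H0 : unb S0) by (intros n; apply NNPP; eauto).
  pose (E := fun n => Nat.iter n nx (exist _ S0 H0)).
  assert (Hdec : forall n m d, (n <= m)%nat ->
    proj1_sig (E m) d -> proj1_sig (E n) d).
  { intros n m d Hle; induction Hle; auto.
    intros H; apply IHHle, Hnx, H. }
  apply (no_infinite_antichain phi
    (fun n d => proj1_sig (E n) d /\ ~ proj1_sig (E (S n)) d) Hadd).
  - intros n m d [H1 H2] [H3 H4].
    destruct (Nat.lt_trichotomy n m) as [H|[H|H]]; auto; exfalso.
    + apply H2, (Hdec _ m); auto.
    + apply H4, (Hdec _ n); auto.
  - intros n; apply Hnx.
Qed.

(* [small] is a notion of smallness for cardinalities.  Write [phi k x] for
   [g x (l k)].  By induction on [n], a set [E] is small if no [k] in [E] admits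
   [n] disjoint [phi k]-positive subsets of [E \ {k}].  Otherwise split [E] into
   [E]-many copies [F i] of [E], and choose by induction [k i] in [F i] such that
   [F i \ {k i}] has [n - 1] disjoint positive subsets.  Then [T = {k i}] has no
   positive set in [T \ {k i}], for this would give an [n]-th one in
   [E \ {k i}].  Hence [g] maps the indicator function of [T] to a function with
   support of size at least [T]. *)
Lemma large_support {D L} (small : Type -> Prop) (g : (D -> Z) -> L -> Z) :
  (forall X Y, cle X Y -> small Y -> small X) ->
  (forall X (t : X -> nat), (forall n, small {x | t x = n}) -> small X) ->
  (forall X, ~ small X -> cle nat X) ->
  (forall l, additive (fun x => g x l)) ->
  (forall k, exists l, g (delta k) l <> 0) ->
  ~ small D -> exists x, ~ small (supp (g x)).
Proof.
  intros Hmono Hunion Hinf Hadd Hne HD; apply NNPP; intros Hno.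
  assert (Hsm : forall x, small (supp (g x))).
  { intros x; apply NNPP; eauto. }
  clear Hno; apply fun_choice in Hne; destruct Hne as [l Hl].
  pose (phi := fun k x => g x (l k)).
  pose (minus := fun (E : D -> Prop) k d => E d /\ d <> k).
  (* If [minus E k] is null for [phi k] throughout, the image of the indicator function of [E]
     agrees at [l k] with that of [delta k], so it is nonzero there. *)
  assert (Hfree : forall E, (forall k, E k -> ~ positive (phi k) (minus E k)) ->
    small {k | E k}).
  { intros E HE.
    assert (Hz : forall k x, E k -> (forall d, ~ minus E k d -> x d = 0) ->
      phi k x = 0).
    { intros k x Ek Hx; apply NNPP; intros Hp; apply (HE k Ek).
      exists x; auto. }
    apply (Hmono _ (supp (g (restr E (fun _ => 1))))); auto.
    apply (cle_sub E _ l).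
    - intros k Ek.
      change (phi k (restr E (fun _ => 1)) <> 0).
      rewrite (restr_split (eq k) (restr E (fun _ => 1))).
      unfold phi at 1; rewrite Hadd.
      replace (restr (eq k) (restr E (fun _ => 1))) with (delta k).
      + change (phi k (delta k) +
          phi k (restr (fun d => k <> d) (restr E (fun _ => 1))) <> 0).
        rewrite (Hz k (restr _ _) Ek).
        * rewrite Z.add_0_r; apply Hl.
        * intros d Hd; unfold minus in Hd.
          destruct (classic (k = d)) as [Ekd|Ekd]; [now apply restr_out|].
          rewrite restr_in by auto; apply restr_out; intros HEd.
          apply Hd; auto.
      + extensionality d; destruct (classic (k = d)) as [<-|Ekd].
        * now rewrite delta_same, !restr_in.
        * now rewrite delta_other, restr_out.
    (* If [l j = l k] with [j <> k], then [delta j] lives on [minus E k] and is killed by [phi k],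
       which is [phi j]. *)
    - intros j k Ej Ek Ejk; apply NNPP; intros Hjk; apply (Hl j).
      rewrite Ejk; apply (Hz k); auto; intros d Hd.
      apply delta_other; intros <-; apply Hd; split; auto. }
  assert (Hind : forall n E, (forall k, E k -> ~ antichain (phi k) n (minus E k)) ->
    small {k | E k}).
  { induction n as [|n IH]; intros E HE; apply NNPP; intros Hbig.
    - destruct (Hinf _ Hbig) as [i _]; destruct (i 0%nat) as [k Ek].
      apply (HE k Ek); exact I.
    - destruct (cle_square _ (Hinf _ Hbig)) as [p Hp].
      pose (F := fun i d => exists j, proj1_sig (p (i, j)) = d).
      assert (HF : forall i, exists k, F i k /\ antichain (phi k) n (minus (F i) k)).
      { intros i; apply NNPP; intros H; apply Hbig.
        apply (Hmono _ {k | F i k}).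
        - exists (fun j => exist (F i) (proj1_sig (p (i, j)))
            (ex_intro (fun j' => proj1_sig (p (i, j')) = _) j eq_refl)).
          intros j j' Ejj; apply (f_equal (@proj1_sig _ _)) in Ejj; simpl in Ejj.
          apply sig_eq, Hp in Ejj; now injection Ejj.
        - apply IH; intros k Fk Hk; apply H; eauto. }
      apply fun_choice in HF; destruct HF as [kk Hkk].
      assert (Fdisj : forall i i' d, F i d -> F i' d -> i = i').
      { intros i i' d [j <-] [j' Ej]; apply sig_eq, Hp in Ej; now injection Ej. }
      assert (HFE : forall i d, F i d -> E d).
      { intros i d [j <-]; apply proj2_sig. }
      pose (T := fun d => exists i, kk i = d).
      apply Hbig, (Hmono _ {k | T k}).
      + exists (fun i => exist T (kk i) (ex_intro (fun i' => kk i' = _) i eq_refl)).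
        intros i i' Eii; apply (f_equal (@proj1_sig _ _)) in Eii; simpl in Eii.
        apply (Fdisj _ _ (kk i)); [apply Hkk|rewrite Eii; apply Hkk].
      + apply Hfree; intros k [i <-] Hpos; destruct (Hkk i) as [HFi Hch].
        apply (HE (kk i)); [eapply HFE, HFi|].
        exists (minus T (kk i)); split; [|split; auto].
        * intros d [[i' <-] Hd]; split; auto; eapply HFE, Hkk.
        * eapply antichain_mono; [|exact Hch]; simpl.
          intros d [Fd Hd]; split; [split; [eapply HFE, Fd | auto]|].
          intros [[i' <-] _]; apply Hd; f_equal.
          apply (Fdisj _ _ (kk i')); [apply Hkk | auto]. }
  (* The rank bounds [t k] cut [D] into countably many sets, each of them small by [Hind]. *)
  assert (Hb : forall k, exists n, ~ antichain (phi k) n (minus (fun _ => True) k)).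
  { intros k; apply antichain_bounded, Hadd. }
  apply fun_choice in Hb; destruct Hb as [t Ht].
  apply HD, (Hunion D t); intros n; apply (Hind n).
  intros k <- Hk; apply (Ht k); eapply antichain_mono; [|exact Hk].
  intros d [_ Hd]; split; auto.
Qed.

(** Extension by zero, which embeds [Z^D] into [Z^E] when [j] is injective. *)
Definition extend {D E : Type} (j : D -> E) (x : D -> Z) : E -> Z :=
  fun e => match excluded_middle_informative (exists d, j d = e) with
           | left H => x (proj1_sig (constructive_indefinite_description _ H))
           | right _ => 0
           end.

Lemma extend_out {D E} (j : D -> E) x e :
  ~ (exists d, j d = e) -> extend j x e = 0.
Proof.
  intros H; unfold extend.
  destruct (excluded_middle_informative (exists d, j d = e)); tauto.
Qed.

Lemma extend_in {D E} (j : D -> E) x d :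
  (forall a b, j a = j b -> a = b) -> extend j x (j d) = x d.
Proof.
  intros Hj; unfold extend.
  destruct (excluded_middle_informative (exists d', j d' = j d)) as [H|H].
  - destruct (constructive_indefinite_description _ H) as [d' E']; simpl.
    now rewrite (Hj _ _ E').
  - destruct H; eauto.
Qed.

Lemma extend_add {D E} (j : D -> E) x y :
  extend j (fun d => x d + y d) = (fun e => extend j x e + extend j y e).
Proof.
  extensionality e; unfold extend.
  destruct (excluded_middle_informative (exists d, j d = e)); lia.
Qed.

Lemma extend_delta {D E} (j : D -> E) k :
  (forall a b, j a = j b -> a = b) -> extend j (delta k) = delta (j k).
Proof.
  intros Hj; extensionality e.
  destruct (classic (exists d, j d = e)) as [[d <-]|H].
  - rewrite extend_in by auto; destruct (classic (k = d)) as [->|Hkd].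
    + now rewrite !delta_same.
    + rewrite !delta_other; auto.
  - rewrite extend_out, delta_other; auto; intros E'; apply H; eauto.
Qed.

Lemma supp_extend {D E} (j : D -> E) x : cle (supp (extend j x)) (supp x).
Proof.
  destruct (fun_choice (fun (e : supp (extend j x)) (d : supp x) =>
    j (proj1_sig d) = proj1_sig e)) as [f Hf].
  { intros [e He]; simpl; revert He; unfold extend.
    destruct (excluded_middle_informative (exists d, j d = e)) as [H|H];
      [|now intros []].
    destruct (constructive_indefinite_description _ H) as [d E']; simpl.
    intros Hd; exists (exist _ d Hd); auto. }
  exists f; intros e e' Eq; apply sig_eq; rewrite <- !Hf; congruence.
Qed.

Lemma delta_inj {D} (k k' : D) : delta k = delta k' -> k = k'.
Proof.
  intros E; apply NNPP; intros H.
  assert (E1 : delta k k = delta k' k) by now rewrite E.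
  rewrite delta_same, delta_other in E1 by auto; discriminate.
Qed.

(* If [B] is uncountable and a countable union of sets [{t = n}] smaller than [B],
   then [large_support] applies to the notion [cle _ (M n)] of smallness.  In each
   coordinate the values on the functions [xs n] form a finitely supported
   sequence, so only countably many sequences occur, and one of them occurs at
   more than [M n] coordinates. *)
Lemma full_support {B L} (g : (B -> Z) -> L -> Z) :
  cle nat B -> (forall l, additive (fun x => g x l)) ->
  (forall k, exists l, g (delta k) l <> 0) ->
  exists x, cle B (supp (g x)).
Proof.
  intros hB Hadd Hne.
  (* If [B] is no countable union of smaller sets, then being smaller than [B] is an admissible
     notion of smallness. *)
  destruct (classic (forall t : B -> nat, exists n, cle B {b | t b = n}))
    as [HI|HII].
  { destruct (large_support (fun X => ~ cle B X) g) as [x Hx]; auto.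
    - eauto using cle_trans.
    - intros X t Ht [h Hh].
      destruct (HI (fun b => t (h b))) as [n Hn]; apply (Ht n).
      eapply cle_trans; [exact Hn|]; apply (cle_sub _ _ h); auto.
    - intros X HX; apply NNPP in HX; eauto using cle_trans.
    - intros H; apply H, cle_refl.
    - exists x; now apply NNPP. }
  destruct (classic (cle B nat)) as [Hct|Hunct].
  (* The unit vectors on a copy of [nat] are glued so that no coordinate [ll n] vanishes. A given
     coordinate is [ll n] for finitely many [n] only, so infinitely many coordinates arise. *)
  { clear HII; destruct hB as [i Hi].
    pose (g' := fun a => g (extend i a)).
    assert (Hadd' : forall l, additive (fun a => g' a l)).
    { intros l a b; unfold g'; rewrite extend_add; apply Hadd. }
    assert (Hne' : forall n, exists l, g' (delta n) l <> 0).
    { intros n; unfold g'; rewrite extend_delta by auto; apply Hne. }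
    apply fun_choice in Hne'; destruct Hne' as [ll Hll].
    assert (Ed : forall m : nat, restr (fun d => d = m) (fun _ => 1) = delta m).
    { intros m; extensionality d; destruct (classic (m = d)) as [->|H].
      - now rewrite restr_in, delta_same.
      - rewrite restr_out, delta_other; auto. }
    destruct (glue_supports g' (fun d => d) (fun _ => 1) (fun n l => l = ll n)
      (fun n m => g' (delta m) (ll n))) as [x Hx]; auto.
    - eauto.
    - intros n l m ->; now rewrite Ed.
    - exists (extend i x); eapply cle_trans; [exact Hct|].
      apply (cle_nat_finite_to_one
        (fun n => exist (fun l => g' x l <> 0) (ll n) (Hx n _ eq_refl))).
      intros [l Hl].
      destruct (specker_eventually (fun a => g' a l) (fun d => d) (fun _ => 1)
        (Hadd' l)) as [N HN].
      exists N; intros n Hn [= E]; apply (Hll n); rewrite E, <- Ed; auto. }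
  apply not_all_ex_not in HII; destruct HII as [t Ht].
  assert (Ht' : forall n, ~ cle B {b | t b = n}) by eauto; clear Ht.
  (* The blocks up to [n], with [nat] added to make the set infinite; this does not reach [B], which
     is uncountable. *)
  pose (M := fun n => ({b | (t b <= n)%nat} + nat)%type).
  assert (HMnat : forall n, cle nat (M n)) by (intros n; apply cle_sum_inr).
  assert (HM : forall n, ~ cle B (M n)).
  { intros n; apply not_cle_sum; auto; induction n as [|n IH].
    - intros H; apply (Ht' 0%nat); eapply cle_trans; [exact H|].
      apply cle_incl; intros; lia.
    - intros H; apply (not_cle_sum _ _ _ Hunct IH (Ht' (S n))).
      eapply cle_trans; [exact H|].
      exists (fun b : {b | (t b <= S n)%nat} =>
        match le_lt_dec (t (proj1_sig b)) n with
        | left Hb => inl (exist (fun b => (t b <= n)%nat) _ Hb)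
        | right Hb => inr (exist (fun b => t b = S n) (proj1_sig b)
            (Nat.le_antisymm _ _ (proj2_sig b) Hb))
        end).
      intros [b Hb] [b' Hb']; simpl.
      destruct (le_lt_dec (t b) n), (le_lt_dec (t b') n); intros [= E];
        now apply sig_eq. }
  (* [B] contains countably many disjoint copies of itself; the [n]-th one will carry a function
     whose image has support larger than [M n]. *)
  destruct (cle_prod_nat B hB) as [j Hj].
  pose (g' := fun a => g (extend j a)).
  assert (Hadd' : forall l, additive (fun a => g' a l)).
  { intros l a b; unfold g'; rewrite extend_add; apply Hadd. }
  assert (Hx : forall n, exists x : B -> Z,
    ~ cle (supp (g' (extend (fun b => (b, n)) x))) (M n)).
  { intros n; apply (large_support (fun X => cle X (M n))
      (fun x => g' (extend (fun b => (b, n)) x))); auto.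
    - eauto using cle_trans.
    - intros X u Hu; eapply cle_trans; [apply (cle_fibers _ u Hu)|].
      now apply cle_prod_nat.
    - intros X HX; apply not_cle in HX; eauto using cle_trans.
    - intros l x y; rewrite extend_add; apply Hadd'.
    - intros k; unfold g'; rewrite !extend_delta; auto; congruence. }
  apply fun_choice in Hx; destruct Hx as [xs Hxs].
  pose (y := fun d : B * nat => xs (snd d) (fst d)).
  assert (Ey : forall n,
    extend (fun b => (b, n)) (xs n) = restr (fun d => snd d = n) y).
  { intros n; extensionality d; destruct d as [b m].
    destruct (classic (m = n)) as [->|H].
    - rewrite restr_in by auto.
      rewrite (extend_in (fun b => (b, n))) by congruence; auto.
    - rewrite restr_out, extend_out; auto; intros [b' E]; congruence. }
  (* The finitely supported sequence seen by coordinate [l] is stored as a list, padded by the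
     default 0 of [nth]. *)
  assert (Hw : forall l, exists w : list Z, forall m,
    g' (restr (fun d => snd d = m) y) l = nth m w 0).
  { intros l; destruct (specker_eventually (fun a => g' a l) snd y (Hadd' l))
      as [N HN].
    exists (map (fun m => g' (restr (fun d => snd d = m) y) l) (seq 0 N)).
    intros m; destruct (le_lt_dec N m) as [Hm|Hm].
    - rewrite nth_overflow; [auto|now rewrite length_map, length_seq].
    - rewrite nth_indep with
        (d' := (fun m => g' (restr (fun d => snd d = m) y) l) 0%nat)
        by now rewrite length_map, length_seq.
      rewrite (map_nth (fun m => g' (restr (fun d => snd d = m) y) l)).
      now rewrite seq_nth. }
  apply fun_choice in Hw; destruct Hw as [w Hw].
  assert (Hcode : cle (list Z) nat).
  { eapply cle_trans; [apply cle_list|apply cle_Z_nat].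
    exists Z.of_nat; apply Nat2Z.inj. }
  destruct Hcode as [c Hc].
  pose (La := fun n p l => g' (restr (fun d => snd d = n) y) l <> 0 /\ c (w l) = p).
  (* The support of the image of [xs n] is the union of the countably many classes [La n p]; if each
     embedded in [M n], so would the support. *)
  assert (Hp : forall n, exists p, ~ cle {l | La n p l} (M n)).
  { intros n; apply NNPP; intros H; apply (Hxs n); rewrite Ey.
    eapply cle_trans; [|apply cle_prod_nat, HMnat].
    apply (cle_fibers _ (fun l => c (w (proj1_sig l)))); intros p.
    apply cle_trans with {l | La n p l}.
    - exists (fun l => exist (La n p) (proj1_sig (proj1_sig l))
        (conj (proj2_sig (proj1_sig l)) (proj2_sig l))).
      intros a b E; apply (f_equal (@proj1_sig _ _)) in E; simpl in E.
      now apply sig_eq, sig_eq.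
    - apply NNPP; eauto. }
  apply fun_choice in Hp; destruct Hp as [p Hp].
  assert (Hne' : forall n, exists l, La n (p n) l).
  { intros n; apply NNPP; intros H; apply (Hp n).
    exists (fun a => False_rect _ (H (ex_intro _ _ (proj2_sig a)))).
    intros a; destruct (H (ex_intro _ _ (proj2_sig a))). }
  pose proof Hne' as Hl; apply fun_choice in Hl; destruct Hl as [l0 Hl0].
  destruct (glue_supports g' snd y (fun n l => La n (p n) l)
    (fun n m => nth m (w (l0 n)) 0)) as [x Hx]; auto.
  { intros n l m [_ Hl]; rewrite Hw; destruct (Hl0 n) as [_ Hl'].
    f_equal; apply Hc; congruence. }
  { intros n; rewrite <- Hw; apply Hl0. }
  exists (extend j x); change (cle B (supp (g' x))).
  assert (HMx : forall n, cle (M n) (supp (g' x))).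
  { intros n; apply not_cle; intros H; apply (Hp n).
    eapply cle_trans; [|exact H].
    apply (cle_incl _ (fun l => g' x l <> 0)); apply Hx. }
  assert (Hnat : cle nat (supp (g' x))).
  { eapply cle_trans; [apply (HMnat 0%nat)|apply HMx]. }
  (* [B] is the union of the blocks [t = n], each of which embeds in [M n] and so in the support. *)
  eapply cle_trans; [|apply cle_prod_nat, Hnat].
  apply (cle_fibers _ t); intros n; eapply cle_trans; [|apply (HMx n)].
  eapply cle_trans; [|apply cle_sum_inl]; apply cle_incl; intros; lia.
Qed.

(** * Embeddings *)

Lemma ceq_cle X Y : ceq X Y -> cle X Y.
Proof. intros (f & Hf & _); exists f; auto. Qed.

Lemma ceq_sym X Y : ceq X Y -> ceq Y X.
Proof.
  intros (f & Hf & Hs); apply fun_choice in Hs; destruct Hs as [h Hh].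
  exists h; split.
  - intros x y E; rewrite <- (Hh x), <- (Hh y); congruence.
  - intros x; exists (f x); apply Hf, Hh.
Qed.

Lemma ceq_trans X Y W : ceq X Y -> ceq Y W -> ceq X W.
Proof.
  intros (f & Hf & Hfs) (g & Hg & Hgs); exists (fun x => g (f x)); split; auto.
  intros w; destruct (Hgs w) as [y <-], (Hfs y) as [x <-]; eauto.
Qed.

Lemma ceq_range {X Y} (i : X -> Y) : (forall a b, i a = i b -> a = b) ->
  ceq X {y | exists x, i x = y}.
Proof.
  intros Hi.
  exists (fun x => exist (fun y => exists x, i x = y) (i x) (ex_intro _ x eq_refl)).
  split.
  - intros a b E; apply (f_equal (@proj1_sig _ _)) in E; auto.
  - intros [y [x E]]; exists x; now apply sig_eq.
Qed.

Lemma clt_cle X Y W : cle X Y -> clt Y W -> clt X W.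
Proof.
  intros H [_ H2]; apply clt_intro; intros H'; apply H2; eauto using cle_trans.
Qed.

Lemma inP_delta K A (k : K) : infinite_card A -> inP K A (delta k).
Proof.
  intros hA; apply clt_intro; intros H.
  destruct (cle_trans _ _ _ hA H) as [i Hi].
  enough (0%nat = 1%nat) by discriminate; apply Hi, sig_eq.
  assert (Hk : forall a : supp (delta k), proj1_sig a = k).
  { intros [a Ha]; simpl; apply NNPP; intros Hne; apply Ha, delta_other; auto. }
  now rewrite !Hk.
Qed.

Lemma inP_extend {D} K A (j : D -> K) x : ~ cle A D -> inP K A (extend j x).
Proof.
  intros HD; apply clt_intro; intros H; apply HD.
  eapply cle_trans; [exact H|]; eapply cle_trans; [apply supp_extend|].
  apply cle_sig.
Qed.

Lemma embedding_delta {K A L} (f : (K -> Z) -> L -> Z) k : infinite_card A ->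
  (forall x y, inP K A x -> inP K A y ->
     f (fun k => x k + y k) = (fun l => f x l + f y l)) ->
  (forall x y, inP K A x -> inP K A y -> f x = f y -> x = y) ->
  exists l, f (delta k) l <> 0.
Proof.
  intros hA Hadd Hinj; apply NNPP; intros H.
  assert (H0 : inP K A (fun _ => 0)).
  { apply clt_cle with (supp (delta k)); [|now apply inP_delta].
    apply (cle_incl (fun _ : K => 0 <> 0)); tauto. }
  assert (E : f (delta k) = f (fun _ => 0)).
  { extensionality l; transitivity 0.
    - apply NNPP; eauto.
    - pose proof (f_equal (fun h => h l) (Hadd _ _ H0 H0)) as E; simpl in E; lia. }
  apply Hinj in E; auto; [|now apply inP_delta].
  pose proof (f_equal (fun h => h k) E) as E'; simpl in E'.
  rewrite delta_same in E'; discriminate.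
Qed.

Lemma P_embeds_uncountable K L A B :
  infinite_card L -> infinite_card A -> le_succ A K -> infinite_card B ->
  ~ cle A nat -> P_embeds K A L B -> cle K L /\ cle A B.
Proof.
  intros hL hA hAK hB hAn (f & HfP & Hadd & Hinj).
  (* All functions on a set smaller than [A] extend to elements of [P(K, A)], so there [f] is
     additive without restriction. *)
  assert (Hg : forall D (j : D -> K) l, ~ cle A D ->
    additive (fun x => f (extend j x) l)).
  { intros D j l HD x y; rewrite extend_add, Hadd; auto using inP_extend. }
  split.
  - assert (Hl : forall k, exists l, f (delta k) l <> 0).
    { intros k; apply (@embedding_delta K A); auto. }
    apply fun_choice in Hl; destruct Hl as [l Hl].
    eapply cle_trans; [|apply cle_square, hL].
    apply cle_trans with (nat * L)%type;
      [|apply cle_prod; auto using cle_refl].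
    (* An infinite fiber of [l] would yield, along [j'], an additive map on sequences that kills no
       unit vector. *)
    apply (cle_fibers nat l); intros c; apply not_cle; intros [j Hj].
    pose (j' := fun n => proj1_sig (j n)).
    assert (Hj' : forall a b, j' a = j' b -> a = b).
    { intros a b E; apply Hj, sig_eq, E. }
    destruct (specker_vanish_once _ (Hg nat j' c hAn)) as [n Hn].
    rewrite extend_delta in Hn by auto.
    apply (Hl (j' n)); unfold j' at 2; now rewrite (proj2_sig (j n)).
  - apply NNPP; intros HAB; destruct (not_cle _ _ HAB) as [i Hi].
    destruct (ceq_range i Hi) as (r & Hr & Hrs).
    (* The copy of [B] in [A] is a subset smaller than [A], to which [le_succ] applies. *)
    assert (HBK : cle B K).
    { eapply cle_trans; [exists r; exact Hr|]; apply hAK, clt_intro.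
      intros H; apply HAB; eapply cle_trans; [exact H|].
      apply ceq_cle, ceq_sym, ceq_range, Hi. }
    destruct HBK as [j Hj].
    destruct (full_support (fun x => f (extend j x)) hB) as [x Hx].
    + intros l; now apply Hg.
    + intros k; rewrite extend_delta by auto; apply (@embedding_delta K A); auto.
    + destruct (HfP (extend j x)) as [_ H]; [now apply inP_extend | auto].
Qed.

(** * Cardinal powers and families of small sets *)

Lemma card_representatives (B : Type) : exists R : (B -> Prop) -> Prop,
  (forall S, R S -> clt {b : B | S b} B) /\
  (forall S T, R S -> R T -> ceq {b : B | S b} {b : B | T b} -> S = T) /\
  (forall S, clt {b : B | S b} B ->
     exists T, R T /\ ceq {b : B | S b} {b : B | T b}).
Proof.
  (* Equinumerous sets define the same predicate, from which [epsilon] picks the same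
     representative. *)
  pose (rep := fun S : B -> Prop =>
    epsilon (inhabits S) (fun T => ceq {b : B | S b} {b : B | T b})).
  assert (Hrep : forall S, ceq {b : B | S b} {b : B | rep S b}).
  { intros S; apply epsilon_spec; exists S; exists (fun b => b); eauto. }
  assert (Heq : forall S T, ceq {b : B | S b} {b : B | T b} -> rep S = rep T).
  { intros S T H; unfold rep.
    replace (fun T0 => ceq {b : B | S b} {b : B | T0 b})
      with (fun T0 => ceq {b : B | T b} {b : B | T0 b}).
    - f_equal; apply proof_irrelevance.
    - extensionality V; apply propositional_extensionality; split; intros H'.
      + eapply ceq_trans; eauto.
      + eapply ceq_trans; [apply ceq_sym|]; eauto. }
  exists (fun S => clt {b : B | S b} B /\ S = rep S); split; [tauto|split].
  - intros S T [_ ->] [_ ->] H; rewrite (Heq _ _ (Hrep S)), (Heq _ _ (Hrep T)).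
    now apply Heq.
  - intros S HS; exists (rep S); split; [split|]; auto.
    eapply clt_cle; [apply ceq_cle, ceq_sym, Hrep | auto].
Qed.

(** [x k] is recovered from a function that enumerates codes of the pairs [(l, x k l)] with [l] in
    the support; its domain is the representative of the cardinality of the support. *)
Lemma P_card_le_pow K L B (x : K -> L -> Z) : infinite_card L ->
  (forall k, inP L B (x k)) -> (forall k k', x k = x k' -> k = k') ->
  le_pow_lt K L B.
Proof.
  intros hL Hx Hinj.
  destruct (card_representatives B) as (R & H1 & H2 & H3).
  exists R; split; [|split; [|split]]; auto.
  assert (Hc : cle (L * Z) L).
  { eapply cle_trans; [|apply cle_prod_nat, hL].
    apply cle_prod; [apply cle_refl | apply cle_Z_nat]. }
  destruct Hc as [c Hc].
  destruct (fun_choice (fun k (p : {p : {S : B -> Prop | R S} &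
    ({b : B | proj1_sig p b} -> L)}) => forall l z, z <> 0 ->
      (x k l = z <-> exists b, projT2 p b = c (l, z)))) as [e He].
  { intros k; destruct (Hx k) as [[i Hi] Hlt].
    pose proof (ceq_range i Hi) as Hr.
    destruct (H3 (fun b => exists a, i a = b)) as (T & RT & HT).
    { eapply clt_cle; [apply ceq_cle, ceq_sym, Hr | apply Hx]. }
    destruct (ceq_sym _ _ (ceq_trans _ _ _ Hr HT)) as (u & Hu & Hus).
    exists (existT (fun p : {S : B -> Prop | R S} => {b : B | proj1_sig p b} -> L)
      (exist R T RT) (fun b => c (proj1_sig (u b), x k (proj1_sig (u b))))).
    intros l z Hz; simpl; split.
    - intros E; assert (Hl : x k l <> 0) by congruence.
      destruct (Hus (exist _ l Hl)) as [b Eb]; exists b.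
      rewrite Eb; simpl; congruence.
    - intros [b Eb]; apply Hc in Eb; congruence. }
  exists e; intros k k' E; apply Hinj; extensionality l.
  assert (Hle : forall k k', e k = e k' -> x k l <> 0 -> x k' l = x k l).
  { clear - He; intros k k' E Hl; apply (He k'); auto.
    rewrite <- E; now apply (He k). }
  destruct (Z.eq_dec (x k l) 0) as [E1|E1].
  - destruct (Z.eq_dec (x k' l) 0) as [E2|E2]; [congruence|auto].
  - symmetry; auto.
Qed.

(** The images of the unit vectors are already [K] many distinct elements of [P(L, B)]. *)
Lemma P_embeds_countable K L A B : infinite_card L -> infinite_card A ->
  P_embeds K A L B -> le_pow_lt K L B.
Proof.
  intros hL hA (f & HfP & Hadd & Hinj).
  apply (P_card_le_pow K L B (fun k => f (delta k))); auto.
  - intros k; apply HfP, inP_delta, hA.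
  - intros k k' E; apply delta_inj, Hinj; auto using inP_delta.
Qed.

Lemma P_embeds_incl K L A B : cle K L -> cle A B -> P_embeds K A L B.
Proof.
  intros [j Hj] HAB; exists (extend j); split; [|split].
  - intros x [_ Hx]; apply clt_intro; intros H; apply Hx.
    eapply cle_trans; [exact HAB|]; eapply cle_trans; [exact H|apply supp_extend].
  - intros; apply extend_add.
  - intros x y _ _ E; extensionality k.
    rewrite <- (extend_in j x k Hj), E; now apply extend_in.
Qed.

(* A function [h : S -> L] is encoded by its graph, transported along an
   injection of [S] into [L]; the cardinality of [S] determines [S]. *)
Lemma pow_lt_graphs K L B : le_succ B L -> le_pow_lt K L B ->
  exists e : K -> L * L -> Prop,
    (forall k k', e k = e k' -> k = k') /\ (forall k, clt {p | e k p} B).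
Proof.
  intros hBL (R & H1 & H2 & _ & [i Hi]).
  pose (Sig := {p : {S : B -> Prop | R S} & ({b : B | proj1_sig p b} -> L)}).
  pose (m := fun p : {S : B -> Prop | R S} =>
    proj1_sig (constructive_indefinite_description _
      (hBL _ (H1 _ (proj2_sig p))))).
  assert (Hm : forall p b b', m p b = m p b' -> b = b').
  { intros p; exact (proj2_sig (constructive_indefinite_description _
      (hBL _ (H1 _ (proj2_sig p))))). }
  pose (gr := fun (p : Sig) (q : L * L) =>
    exists b, q = (m (projT1 p) b, projT2 p b)).
  assert (Hmatch : forall p p', gr p = gr p' -> forall b, exists b',
    m (projT1 p') b' = m (projT1 p) b /\ projT2 p' b' = projT2 p b).
  { intros p p' E b.
    assert (H : gr p (m (projT1 p) b, projT2 p b)) by (exists b; auto).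
    rewrite E in H; destruct H as [b' [= Ea Eb]]; eauto. }
  assert (Hgr : forall p p', gr p = gr p' -> p = p').
  { intros p p' E.
    assert (Eq : projT1 p = projT1 p').
    { apply sig_eq, H2; try apply proj2_sig.
      pose proof (Hmatch p p' E) as H; apply fun_choice in H.
      destruct H as [u Hu]; exists u; split.
      - intros b b' Eb; apply (Hm (projT1 p)).
        rewrite <- (proj1 (Hu b)), <- (proj1 (Hu b')); congruence.
      - intros b'; destruct (Hmatch p' p (eq_sym E) b') as [b [Hb _]].
        exists b; apply (Hm (projT1 p')); rewrite (proj1 (Hu b)); auto. }
    pose proof (Hmatch p p' E) as H; clear Hmatch E.
    destruct p as [S h], p' as [S' h']; simpl in *; subst S'.
    f_equal; extensionality b; destruct (H b) as [b' [Ea Eb]].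
    apply Hm in Ea; congruence. }
  exists (fun k => gr (i k)); split; [auto|].
  intros k; eapply clt_cle; [|apply (H1 _ (proj2_sig (projT1 (i k))))].
  destruct (fun_choice (fun (q : {q | gr (i k) q}) b =>
    proj1_sig q = (m (projT1 (i k)) b, projT2 (i k) b))) as [u Hu].
  { intros [q [b Hb]]; exists b; auto. }
  exists u; intros q q' E; apply sig_eq; rewrite !Hu; congruence.
Qed.

(** * Finite sums and independent families *)

Definition lsum {K : Type} (x : K -> Z) (w : list K) : Z :=
  fold_right (fun k s => x k + s) 0 w.

Lemma lsum_add {K} (x y : K -> Z) w :
  lsum (fun k => x k + y k) w = lsum x w + lsum y w.
Proof. induction w; simpl; lia. Qed.

Lemma lsum_perm {K} (x : K -> Z) v w : Permutation v w -> lsum x v = lsum x w.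
Proof. induction 1; simpl; lia. Qed.

(** Without their zero terms both lists enumerate the support, hence are permutations of each
    other. *)
Lemma lsum_support {K} (x : K -> Z) v w : NoDup v -> NoDup w ->
  (forall k, x k <> 0 -> In k v) -> (forall k, x k <> 0 -> In k w) ->
  lsum x v = lsum x w.
Proof.
  intros Nv Nw Hv Hw.
  pose (nz := fun k => negb (x k =? 0)).
  assert (Hnz : forall k, nz k = true <-> x k <> 0).
  { intros k; unfold nz; destruct (Z.eqb_spec (x k) 0); simpl; intuition congruence. }
  assert (Hf : forall u, lsum x u = lsum x (filter nz u)).
  { induction u as [|k u IH]; simpl; auto.
    destruct (nz k) eqn:E; simpl; [lia|].
    enough (x k = 0) by lia.
    apply NNPP; intros H; apply Hnz in H; congruence. }
  rewrite (Hf v), (Hf w); apply lsum_perm, NoDup_Permutation;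
    auto using NoDup_filter.
  intros k; rewrite !filter_In, Hnz; split; intros []; auto.
Qed.

(* The sum of the values of a finitely supported function, and junk for other
   functions. *)
Definition fsum {K : Type} (x : K -> Z) : Z :=
  lsum x (epsilon (inhabits nil) (fun w => NoDup w /\ forall k, x k <> 0 -> In k w)).

Lemma fsum_eq {K} (x : K -> Z) w :
  NoDup w -> (forall k, x k <> 0 -> In k w) -> fsum x = lsum x w.
Proof.
  intros Nw Hw.
  destruct (epsilon_spec (inhabits nil)
    (fun w => NoDup w /\ forall k, x k <> 0 -> In k w)) as [Nv Hv]; [eauto|].
  now apply lsum_support.
Qed.

Lemma common_support {K} (x y : K -> Z) :
  ~ cle nat (supp x) -> ~ cle nat (supp y) ->
  exists w, NoDup w /\ forall k, x k <> 0 \/ y k <> 0 -> In k w.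
Proof.
  intros Hx Hy.
  destruct (finite_sig_enum _ Hx) as [v [_ Hv]], (finite_sig_enum _ Hy) as [w [_ Hw]].
  exists (nodup (fun x y => excluded_middle_informative (x = y)) (v ++ w)).
  split; [apply NoDup_nodup|]; intros k Hk.
  rewrite nodup_In, in_app_iff, Hv, Hw; auto.
Qed.

Lemma exists_maximal {K X} (e : K -> X -> Prop) w : w <> nil ->
  exists k, In k w /\ forall k', In k' w ->
    (forall p, e k p -> e k' p) -> (forall p, e k' p -> e k p).
Proof.
  induction w as [|k0 w IH]; [congruence|]; intros _.
  destruct w as [|k1 w].
  { exists k0; split; [left; auto|]; intros k' [<-|[]]; auto. }
  destruct IH as (k & Hk & Hmax); [discriminate|].
  destruct (classic (forall p, e k p -> e k0 p)) as [H|H].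
  - exists k0; split; [left; auto|]; intros k' [<-|Hk']; auto.
    intros Hsub p Hp; apply H, (Hmax k' Hk'); auto.
  - exists k; split; [right; auto|]; intros k' [<-|Hk'] Hsub.
    + tauto.
    + exact (Hmax k' Hk' Hsub).
Qed.

(* For distinct sets [e k] the functions [w |-> [all elements of w are in e k]]
   on lists are linearly independent: if [e k] is maximal among finitely many of
   the sets, then some list of elements of [e k] is contained in no other one. *)
Lemma P_embeds_free K A L B (e : K -> L * L -> Prop) :
  infinite_card L -> cle A nat -> infinite_card A -> ~ cle B nat ->
  (forall k k', e k = e k' -> k = k') -> (forall k, clt {p | e k p} B) ->
  P_embeds K A L B.
Proof.
  intros hL hAn hA hB Hinj Hlt.
  assert (Hc : cle (list (L * L)) L).
  { eapply cle_trans; [apply cle_list|apply cle_square, hL].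
    eapply cle_trans; [exact hL|]; destruct hL as [i _].
    exists (fun l => (l, i 0%nat)); congruence. }
  destruct Hc as [c Hc].
  assert (Hfin : forall x, inP K A x -> ~ cle nat (supp x)).
  { intros x [_ Hx] H; apply Hx; eauto using cle_trans. }
  (* With this cut, [f x] takes at [c w] the sum of the [x k] over all [k] for which [e k] contains
     the elements of [w]. *)
  pose (part := fun x w => restr (fun k => Forall (e k) w) x : K -> Z).
  assert (Hpart : forall x w k, part x w k <> 0 -> x k <> 0 /\ Forall (e k) w).
  { unfold part, restr; intros x w k.
    destruct (excluded_middle_informative (Forall (e k) w)); tauto. }
  pose (f := fun x => extend c (fun w => fsum (part x w))).
  assert (Hadd : forall x y, inP K A x -> inP K A y ->
    f (fun k => x k + y k) = (fun l => f x l + f y l)).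
  { intros x y Hx Hy; unfold f; rewrite <- extend_add; f_equal.
    extensionality w; unfold part; rewrite restr_add; fold (part x w) (part y w).
    destruct (common_support x y) as (v & Nv & Hv); auto.
    rewrite !(fsum_eq _ v); auto using lsum_add.
    - intros k Hk; apply Hv; right; now apply (Hpart y w).
    - intros k Hk; apply Hv; left; now apply (Hpart x w).
    - intros k Hk; apply Hv.
      destruct (Z.eq_dec (part x w k) 0) as [E|E].
      + right; apply (Hpart y w); lia.
      + left; now apply (Hpart x w). }
  assert (Hker : forall z, inP K A z -> f z = (fun _ => 0) -> forall k, z k = 0).
  { intros z Hz E.
    destruct (finite_sig_enum _ (Hfin z Hz)) as [v [Nv Hv]].
    enough (v = nil).
    { intros k; apply NNPP; intros Hk; apply Hv in Hk; subst v; destruct Hk. }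
    apply NNPP; intros Hne.
    destruct (exists_maximal e v Hne) as (k & Hk & Hmax).
    (* [w] collects, for each [k'] other than [k], a point of [e k] outside [e k']; it exists as
       [e k] is maximal and the sets are distinct. At this [w] only the term [z k] survives. *)
    assert (Hw : forall u, (forall k', In k' u -> In k' v) -> exists w,
      Forall (e k) w /\ forall k', In k' u -> Forall (e k') w -> k' = k).
    { induction u as [|k0 u IH]; intros Hu.
      - exists nil; split; auto; intros k' [].
      - destruct IH as (w & Hw1 & Hw2); [intros; apply Hu; right; auto|].
        destruct (classic (k0 = k)) as [->|Hne0].
        + exists w; split; auto; intros k' [<-|Hk']; auto.
        + assert (Hp : exists p, e k p /\ ~ e k0 p).
          { apply NNPP; intros H.
            assert (Hsub : forall p, e k p -> e k0 p).
            { intros p Hp; apply NNPP; eauto. }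
            apply Hne0, Hinj; extensionality p.
            apply propositional_extensionality; split; auto.
            apply Hmax; auto; apply Hu; left; auto. }
          destruct Hp as [p [Hp Hp0]].
          exists (p :: w); split; [constructor; auto|].
          intros k' [<-|Hk'] HF; inversion HF; subst; [tauto|auto]. }
    destruct (Hw v) as (w & Hw1 & Hw2); auto.
    apply (proj1 (Hv k) Hk).
    transitivity (fsum (part z w)).
    - rewrite (fsum_eq _ (k :: nil)).
      + unfold lsum; simpl; unfold part; rewrite restr_in by auto; lia.
      + constructor; [intros []|constructor].
      + intros k' Hk'; apply Hpart in Hk'; left; symmetry.
        apply Hw2; [apply Hv|]; tauto.
    - pose proof (f_equal (fun h => h (c w)) E) as E'; simpl in E'.
      unfold f in E'; rewrite extend_in in E' by auto; exact E'. }
  exists f; split; [|split]; auto.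
  - intros x Hx; apply clt_intro; intros HB.
    destruct (finite_sig_enum _ (Hfin x Hx)) as [v [Nv Hv]].
    (* The support of [f x] lies in a finite union of sets of lists over some [e k]; as [B] is
       uncountable, neither these sets nor their union reach [B]. *)
    assert (HU : forall v, ~ cle B {w | exists k, In k v /\ Forall (e k) w}).
    { clear - hB Hlt; induction v as [|k v IH]; intros HB.
      - apply hB; eapply cle_trans; [exact HB|].
        exists (fun _ => 0%nat); intros [w [k [[] _]]].
      - apply (not_cle_sum B {w | Forall (e k) w}
          {w | exists k, In k v /\ Forall (e k) w} hB); auto.
        (* [e k] may be finite; adding [nat] gives an infinite alphabet that still does not reach
           [B]. *)
        + intros H; apply (not_cle_sum B {p | e k p} nat hB); auto.
          { apply Hlt. }
          eapply cle_trans; [exact H|].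
          eapply cle_trans; [|apply cle_list, cle_sum_inr].
          destruct (fun_choice (fun (w : {w | Forall (e k) w})
            (u : list ({p | e k p} + nat)) =>
              map (fun s => match s with inl p => Some (proj1_sig p)
                                       | inr _ => None end) u =
              map Some (proj1_sig w))) as [h Hh].
          { intros [w Hw]; simpl; induction Hw as [|p w Hp Hw [u IHu]].
            - exists nil; auto.
            - exists (inl (exist _ p Hp) :: u); simpl; congruence. }
          exists h; intros w w' E; apply sig_eq.
          assert (Em : map Some (proj1_sig w) = map Some (proj1_sig w'))
            by (rewrite <- !Hh; congruence).
          revert Em; generalize (proj1_sig w) as a, (proj1_sig w') as b.
          induction a as [|p a IHa]; intros [|q b]; simpl; try discriminate;
            auto; intros [= -> Eab]; f_equal; auto.
        + eapply cle_trans; [exact HB|].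
          destruct (fun_choice (fun
            (w : {w | exists k0, In k0 (k :: v) /\ Forall (e k0) w})
            (s : {w | Forall (e k) w} + {w | exists k, In k v /\ Forall (e k) w}) =>
              proj1_sig w = match s with inl a => proj1_sig a
                                       | inr a => proj1_sig a end)) as [h Hh].
          { intros [w [k0 [[<-|Hk0] Hw]]].
            - exists (inl (exist _ w Hw)); auto.
            - exists (inr (exist _ w (ex_intro _ k0 (conj Hk0 Hw)))); auto. }
          exists h; intros w w' E; apply sig_eq; rewrite !Hh; now rewrite E. }
    apply (HU v); eapply cle_trans; [exact HB|].
    eapply cle_trans; [apply supp_extend|].
    apply (cle_incl (fun w => fsum (part x w) <> 0)); intros w Hw.
    apply NNPP; intros Hno; apply Hw.
    rewrite (fsum_eq _ nil); [reflexivity|constructor|].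
    intros k Hk; apply Hpart in Hk; exfalso; apply Hno; exists k.
    rewrite Hv; tauto.
  - intros x y Hx Hy E.
    (* Injectivity reduces to the trivial kernel once the difference is known to lie in [P(K, A)],
       by its finite support. *)
    pose (z := fun k => x k + -1 * y k).
    assert (Hz : inP K A z).
    { destruct (common_support x y) as (v & Nv & Hv); auto.
      apply clt_intro; intros H.
      destruct (cle_trans _ _ _ hA H) as [i Hi].
      assert (Hin : forall n, In (proj1_sig (i n)) v).
      { intros n; apply Hv; destruct (i n) as [k Hk]; simpl; unfold z in Hk.
        destruct (Z.eq_dec (x k) 0); [right|left]; lia. }
      assert (Hle : (length (map (fun n => proj1_sig (i n)) (seq 0 (S (length v))))
        <= length v)%nat).
      { apply NoDup_incl_length.
        - apply Injective_map_NoDup; [|apply seq_NoDup].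
          intros a b Eab; apply Hi, sig_eq, Eab.
        - intros k Hk; apply in_map_iff in Hk; destruct Hk as [n [<- _]]; auto. }
      rewrite length_map, length_seq in Hle; lia. }
    assert (Ez : f z = (fun _ => 0)).
    { extensionality l.
      pose proof (f_equal (fun h => h l) (Hadd z y Hz Hy)) as E1; simpl in E1.
      replace (fun k => z k + y k) with x in E1
        by (extensionality k; unfold z; lia).
      rewrite E in E1; lia. }
    extensionality k; pose proof (Hker z Hz Ez k) as Hk; unfold z in Hk; lia.
Qed.

Lemma P_embeds_pow K L A B : infinite_card L -> infinite_card A ->
  infinite_card B -> le_succ B L -> le_pow_lt K L B -> cle A nat ->
  P_embeds K A L B.
Proof.
  intros hL hA hB hBL Hpow hAn.
  destruct (pow_lt_graphs K L B hBL Hpow) as (e & He & Hlt).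
  (* For countable [B] the sets [e k] are finite, so [K] embeds in [L] and extension by zero
     suffices; the indicator functions of [P_embeds_free] could have infinite support here. *)
  destruct (classic (cle B nat)) as [hBn|hBn];
    [|exact (P_embeds_free K A L B e hL hAn hA hBn He Hlt)].
  apply P_embeds_incl; [|eauto using cle_trans].
  assert (HLL : cle (L * L) L) by now apply cle_square.
  destruct (fun_choice (fun k w => forall p, In p w <-> e k p)) as [w Hw].
  { intros k; destruct (finite_sig_enum (e k)) as [w [_ Hw]]; eauto.
    intros H; apply (Hlt k); eauto using cle_trans. }
  apply cle_trans with (list (L * L)).
  - exists w; intros k k' E; apply He; extensionality p.
    apply propositional_extensionality; rewrite <- !Hw, E; tauto.
  - eapply cle_trans; [apply cle_list|exact HLL].
    eapply cle_trans; [exact hL|]; destruct hL as [i _].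
    exists (fun l => (l, i 0%nat)); congruence.
Qed.

Theorem theorem1 (K L A B : Type)
  (hK : infinite_card K) (hL : infinite_card L)
  (hA : infinite_card A) (hAK : le_succ A K)
  (hB : infinite_card B) (hBL : le_succ B L) :
  P_embeds K A L B <->
  ((cle K L /\ cle A B) \/ (le_pow_lt K L B /\ ceq A nat)).
Proof.
  split.
  - intros H; destruct (classic (cle A nat)) as [hAn|hAn].
    + right; split; [|now apply cle_antisym].
      exact (P_embeds_countable K L A B hL hA H).
    + left; now apply P_embeds_uncountable.
  - intros [[HKL HAB]|[Hpow HA]].
    + now apply P_embeds_incl.
    + apply P_embeds_pow; auto; now apply ceq_cle.
Qed.
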